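(* Let $q\in(0,1)$, let $\mathfrak{D}_q$ be the algebraic Dirac operator on $SU_q(2)$, and let $\tilde D_q=D_q-\tfrac32\mathbf 1$ be the geometric Dirac operator on $SU_q(2)$ without its constant term, both acting on $L^2(SU_q(2))\otimes V_{q,\frac12}$ (all defined in the context). Then $$\mathfrak{D}_q=[\tilde D_q]=\frac{q^{\tilde D_q}-q^{-\tilde D_q}}{q-q^{-1}} .$$
   Context: $[n]:=(q^n-q^{-n})/(q-q^{-1})$. **Quantum algebra.** $U_q(\mathfrak{su}_2)$ is the Hopf $*$-algebra generated by $e,f,k,k^{-1}$ with $kk^{-1}=1$, $kek^{-1}=qe$, $kfk^{-1}=q^{-1}f$, $[e,f]=\frac{k^2-k^{-2}}{q-q^{-1}}$, coproduct $\triangle_q(k)=k\otimes k$, $\triangle_q(e)=e\otimes k+k^{-1}\otimes e$, $\triangle_q(f)=f\otimes k+k^{-1}\otimes f$, antipode $S_q(e)=-qe$, $S_q(f)=-q^{-1}f$, $S_q(k)=k^{-1}$, and involution $e^*=f$, $k^*=k$. For $l\in\frac12\mathbb N_0$ its irreducible unitary representation $(V_{q,l},\pi_{q,l})$ has orthonormal basis $|l,m\rangle$, $m=-l,-l+1,\dots,l$, with $\pi_{q,l}(k)|l,m\rangle=q^m|l,m\rangle$, $\pi_{q,l}(e)|l,m\rangle=\sqrt{[l-m][l+m+1]}\,|l,m+1\rangle$, $\pi_{q,l}(f)|l,m\rangle=\sqrt{[l-m+1][l+m]}\,|l,m-1\rangle$. **Function algebra and Hilbert space.** $\mathbb C[SU_q(2)]=\bigoplus_{l\in\frac12\mathbb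 N_0}V_{q,l}^*\otimes V_{q,l}$ is the dual Hopf $*$-algebra spanned by the matrix coefficients $t^l_{m,n}=\langle l,m|\otimes|l,n\rangle$, regarded as functionals $t^l_{m,n}(x)=\langle l,m|\pi_{q,l}(x)|l,n\rangle$ on $U_q(\mathfrak{su}_2)$. $L^2(SU_q(2))$ is its completion for $\langle t,s\rangle=h(t^*s)$, with $h$ the (normalized) Haar state. $U_q(\mathfrak{su}_2)$ acts on $\mathbb C[SU_q(2)]$ by $\partial(x)(\langle l,m|\otimes v)=\langle l,m|\otimes\pi_{q,l}(x)v$; this extends to $U(G_q)=\prod_l B(V_{q,l})$. **Algebraic Dirac operator.** With respect to the basis $|\tfrac12,\tfrac12\rangle,|\tfrac12,-\tfrac12\rangle$ of $V_{q,\frac12}$, $$\mathfrak D_q=\partial\begin{pmatrix} ef-q^{-2}fe & q^{-\frac12}[2]\,k^{-1}f\\ q^{\frac12}[2]\,k^{-1}e & -q^2ef+fe\end{pmatrix}.$$ **Classical data.** $\mathfrak{su}_2$ (complexified) has generators $j_\pm,j_0$ with $[j_0,j_\pm]=\pm j_\pm$, $[j_+,j_-]=2j_0$, and representations $(V_l,\pi_l)$ with orthonormal basis $|l,m\rangle$: $\pi_l(j_\pm)|l,m\rangle=\sqrt{l(l+1)-m(m\pm1)}\,|l,m\pm1\rangle$, $\pi_l(j_0)|l,m\rangle=m|l,m\rangle$. Put $x_1=j_++j_-$, $x_2=-i(j_+-j_-)$, $x_3=2j_0$ and $T=\sum_{k=1}^3x_k\otimes x_k$. Let $W^*(G)$ (resp.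 $W^*(G_q)$) be the $l^\infty$-direct sum of the $B(V_l)$ (resp. $B(V_{q,l})$), $\triangle$ the primitive coproduct of $W^*(G)$, $\epsilon$ its counit. **Isomorphism and twist.** $\phi:W^*(G_q)\to W^*(G)$ is the $*$-isomorphism (extended to the affiliated algebras $\prod_lB(V_{q,l})\to\prod_l B(V_l)$) obtained by identifying the basis vectors $|l,m\rangle$ of $V_{q,l}$ and $V_l$ for all $l,m$, so $\pi_l\circ\phi=\pi_{q,l}$. $F\in W^*(G)\otimes W^*(G)$ is a fixed unitary such that $(\phi\otimes\phi)\triangle_q(x)=F\,\triangle(\phi(x))F^*$ for all $x\in W^*(G_q)$, $(\epsilon\otimes\mathrm{id})F=(\mathrm{id}\otimes\epsilon)F=1$, $(\phi\otimes\phi)(R^*R)=Fq^{T}F^*$ with $R$ the universal $R$-matrix of $U_q(\mathfrak{su}_2)$, and the associator $(\mathrm{id}\otimes\triangle)(F^* )(1\otimes F^* )(F\otimes1)(\triangle\otimes\mathrm{id})(F)$ equals the Drinfeld (Knizhnik–Zamolodchikov) associator $\Phi_{\mathrm{KZ}}$. (Such $F$ exists.) **Geometric Dirac operator.** The classical Dirac operator is $\mathcal D=\sum_kx_k\otimes\gamma(x_k)+\frac32\mathbf 1$, where the Clifford generators $\gamma(x_k)$ act on the spinor space $\Sigma=V_{\frac12}$ by $\pi_{\frac12}(x_k)$ and $\mathfrak{su}_2$ acts on $\Sigma$ by $\pi_{\frac12}$. The geometric Dirac operator on $SU_q(2)$ is obtained by conjugating $\mathcal D$ with $F$ and transporting by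 $\phi^{-1}$ in the first leg: $D_q=\tilde D_q+\frac32\mathbf 1$ with $\tilde D_q=(\partial\circ\phi^{-1}\otimes\pi_{\frac12})(F\,T\,F^* )$. All these operators are defined on the dense subspace $\mathbb C[SU_q(2)]\otimes V_{q,\frac12}$ (with $V_{q,\frac12}=V_{\frac12}$ via the basis identification), which they preserve, and are essentially self-adjoint there; $q^{\pm\tilde D_q}$ is defined by functional calculus. *)

(* Defs.v *)
From HB Require Import structures.
From mathcomp Require Import all_boot all_order all_algebra.
From mathcomp Require Import mxtens complex.
From mathcomp Require Import all_classical all_reals all_analysis.

Set Implicit Arguments.
Unset Strict Implicit.
Unset Printing Implicit Defensive.

Import Order.TTheory GRing.Theory Num.Theory.
Import numFieldNormedType.Exports.
Local Open Scope classical_set_scope.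
Local Open Scope ring_scope.
Local Open Scope sesquilinear_scope.
Local Open Scope complex_scope.

(* Conventions.
   - A half-integer spin l is represented by n = 2l : nat, so dim V_l = n.+1.
     The index i : 'I_n.+1 stands for the basis vector |l, l - i>; the highest
     weight vector comes first, as in the ordered basis |1/2,1/2>, |1/2,-1/2>.
   - Operators act on column vectors.  V_l (x) V_l' has the basis given by
     mxtens_index, for which A *t B is the tensor product of A and B.
   - The map phi identifies the bases of V_{q,l} and V_l.  The algebras
     prod_l B(V_{q,l}) and prod_l B(V_l) are both represented by [blocks R],
     and phi is the identity of [blocks R]. *)

Section Blocks.
Variable R : realType.

Definition blocks := forall n : nat, 'M[R[i]]_n.+1.
Definition blocks2 := forall n m : nat, 'M[R[i]]_(n.+1 * m.+1).

Definition spin (n : nat) : R := n%:R / 2.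
Definition weight (n : nat) (i : 'I_n.+1) : R := spin n - (i : nat)%:R.

(* Elements of l^oo-sum of the B(V_l) inside the full product. *)
Definition bounded_blocks (x : blocks) : Prop :=
  exists M : R, forall n (v : 'cV[R[i]]_n.+1),
    \sum_i `|(x n *m v) i 0| ^+ 2 <= M%:C * \sum_i `|v i 0| ^+ 2.

(* Functional calculus of a normal matrix, by unitary diagonalization. *)
Definition fun_mx (f : R[i] -> R[i]) d (A : 'M[R[i]]_d) : 'M[R[i]]_d :=
  invmx (spectralmx A) *m diag_mx (map_mx f (spectral_diag A)) *m spectralmx A.

(* q^A for Hermitian A. *)
Definition qpow_mx (q : R) d (A : 'M[R[i]]_d) : 'M[R[i]]_d :=
  fun_mx (fun z => (q `^ complex.Re z)%:C) A.

(* V_a (x) (V_b (x) V_c) = (V_a (x) V_b) (x) V_c; the cast is compatible with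
   mxtens_index, i.e. it preserves the underlying nat of the indices. *)
Definition assoc_mx a b c (A : 'M[R[i]]_(a * (b * c))) : 'M[R[i]]_(a * b * c) :=
  castmx (mulnA a b c, mulnA a b c) A.

End Blocks.

Section Classical.
Variable R : realType.

Definition jp (n : nat) : 'M[R[i]]_n.+1 :=
  \matrix_(i, j) if i.+1 == j :> nat then
    (Num.sqrt (spin R n * (spin R n + 1) - weight R j * (weight R j + 1)))%:C
  else 0.
Definition jm (n : nat) : 'M[R[i]]_n.+1 :=
  \matrix_(i, j) if i == j.+1 :> nat then
    (Num.sqrt (spin R n * (spin R n + 1) - weight R j * (weight R j - 1)))%:C
  else 0.
Definition j0 (n : nat) : 'M[R[i]]_n.+1 := diag_mx (\row_i (weight R i)%:C).

(* x_1, x_2, x_3, indexed from 0. *)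
Definition xgen (k : 'I_3) (n : nat) : 'M[R[i]]_n.+1 :=
  match val k with
  | 0 => jp n + jm n
  | 1 => - 'i%C *: (jp n - jm n)
  | _ => 2 *: j0 n
  end.

Definition Tsym : blocks2 R := fun n m => \sum_(k < 3) xgen k n *t xgen k m.

Definition Dxgen (k : 'I_3) : blocks2 R :=
  fun n m => xgen k n *t 1%:M + 1%:M *t xgen k m.

End Classical.

Section Coproduct.
Variable R : realType.

(* The extension of a coproduct to the product of the B(V_j).  Given operators
   rho a j on the V_j and rho2 a n m on the V_n (x) V_m, x acts on V_n (x) V_m
   by the unique operator X n m such that X n m S = S (x j) for every
   intertwiner S : V_j -> V_n (x) V_m. *)
Variables (I : Type) (rho : I -> blocks R) (rho2 : I -> blocks2 R).

Definition intertwiner j n m (S : 'M[R[i]]_(n.+1 * m.+1, j.+1)) : Prop :=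
  forall a, rho2 a n m *m S = S *m rho a j.

Definition is_coproduct (x : blocks R) (X : blocks2 R) : Prop :=
  forall j n m S, @intertwiner j n m S -> X n m *m S = S *m x j.

(* X = (Delta (x) id)(Y) *)
Definition is_coproduct_l (Y : blocks2 R)
    (X : forall l m n, 'M[R[i]]_(l.+1 * m.+1 * n.+1)) : Prop :=
  forall j l m n S, @intertwiner j l m S ->
    X l m n *m (S *t 1%:M) = (S *t 1%:M) *m Y j n.

(* X = (id (x) Delta)(Y) *)
Definition is_coproduct_r (Y : blocks2 R)
    (X : forall l m n, 'M[R[i]]_(l.+1 * (m.+1 * n.+1))) : Prop :=
  forall j l m n S, @intertwiner j m n S ->
    X l m n *m (1%:M *t S) = (1%:M *t S) *m Y l j.

End Coproduct.

Section QuantumAlgebra.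
Variable R : realType.

(* U_q(su_2) is presented by *-algebra words in the generators.  The defining
   relations are not quotiented out: U_q enters only through functionals and
   operators that factor through the representations pi_{q,l}, which satisfy
   them. *)
Inductive Uq : Type :=
  | Ue | Uf | Uk | Uki | Uone
  | Uadd of Uq & Uq
  | Umul of Uq & Uq
  | Uscale of R[i] & Uq.

Fixpoint Ustar (a : Uq) : Uq :=
  match a with
  | Ue => Uf | Uf => Ue | Uk => Uk | Uki => Uki | Uone => Uone
  | Uadd a b => Uadd (Ustar a) (Ustar b)
  | Umul a b => Umul (Ustar b) (Ustar a)
  | Uscale c a => Uscale (Num.conj c) (Ustar a)
  end.

Fixpoint Ucounit (a : Uq) : R[i] :=
  match a with
  | Ue | Uf => 0 | Uk | Uki | Uone => 1
  | Uadd a b => Ucounit a + Ucounit b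
  | Umul a b => Ucounit a * Ucounit b
  | Uscale c a => c * Ucounit a
  end.

(* The sequence [:: (a1, b1); (a2, b2); ...] stands for the sum of the
   a_i (x) b_i. *)
Fixpoint Ucoprod (a : Uq) : seq (Uq * Uq) :=
  match a with
  | Ue => [:: (Ue, Uk); (Uki, Ue)]
  | Uf => [:: (Uf, Uk); (Uki, Uf)]
  | Uk => [:: (Uk, Uk)]
  | Uki => [:: (Uki, Uki)]
  | Uone => [:: (Uone, Uone)]
  | Uadd a b => Ucoprod a ++ Ucoprod b
  | Umul a b => [seq (Umul s.1 t.1, Umul s.2 t.2) | s <- Ucoprod a, t <- Ucoprod b]
  | Uscale c a => [seq (Uscale c s.1, s.2) | s <- Ucoprod a]
  end.

Variable q : R.

Definition qnum (x : R) : R := (q `^ x - q `^ (- x)) / (q - q^-1).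

Fixpoint Uantipode (a : Uq) : Uq :=
  match a with
  | Ue => Uscale (- q)%:C Ue
  | Uf => Uscale (- q^-1)%:C Uf
  | Uk => Uki | Uki => Uk | Uone => Uone
  | Uadd a b => Uadd (Uantipode a) (Uantipode b)
  | Umul a b => Umul (Uantipode b) (Uantipode a)
  | Uscale c a => Uscale c (Uantipode a)
  end.

Definition pi_e (n : nat) : 'M[R[i]]_n.+1 :=
  \matrix_(i, j) if i.+1 == j :> nat then
    (Num.sqrt (qnum (spin R n - weight R j) * qnum (spin R n + weight R j + 1)))%:C
  else 0.
Definition pi_f (n : nat) : 'M[R[i]]_n.+1 :=
  \matrix_(i, j) if i == j.+1 :> nat then
    (Num.sqrt (qnum (spin R n - weight R j + 1) * qnum (spin R n + weight R j)))%:C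
  else 0.
Definition pi_k (n : nat) : 'M[R[i]]_n.+1 := diag_mx (\row_i (q `^ weight R i)%:C).
Definition pi_ki (n : nat) : 'M[R[i]]_n.+1 :=
  diag_mx (\row_i (q `^ (- weight R i))%:C).

Fixpoint piq (a : Uq) : blocks R := fun n =>
  match a with
  | Ue => pi_e n | Uf => pi_f n | Uk => pi_k n | Uki => pi_ki n | Uone => 1%:M
  | Uadd a b => piq a n + piq b n
  | Umul a b => piq a n *m piq b n
  | Uscale c a => c *: piq a n
  end.

Definition piq2 (a : Uq) : blocks2 R :=
  fun n m => \sum_(s <- Ucoprod a) piq s.1 n *t piq s.2 m.

(* The universal R-matrix of U_q(su_2) for the above coproduct (k^2 = q^h),
   q^(h (x) h / 2) sum_s q^(s(s-1)/2) (q - q^-1)^s / [s]! (ek)^s (x) (k^-1 f)^s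
   with h = 2 j_0; the terms with s > n vanish on V_n (x) V_m. *)
Definition Rmx : blocks2 R := fun n m =>
  qpow_mx q (2 *: (j0 R n *t j0 R m)) *m
  \sum_(s < n.+1)
    (q `^ (s%:R * (s%:R - 1) / 2) * (q - q^-1) ^+ s
      / \prod_(1 <= t < s.+1) qnum t%:R)%:C *:
    ((pi_e n *m pi_k n) ^+ s *t (pi_ki m *m pi_f m) ^+ s).

End QuantumAlgebra.

Section Twist.
Variable R : realType.

(* q = exp (pi i hbar), i.e. hbar = ln q / (pi i); the KZ equation is
   G'(x) = hbar (t_12 / x + t_23 / (x - 1)) G(x) with t = T / 2, so that
   q^T = q^(2t).  Phi_KZ is the limit for a -> 0+ of
   a^(- hbar t_23) G_a(1 - a) a^(hbar t_12), where G_a(a) = 1. *)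
Definition hbar (q : R) : R[i] := - 'i%C * (ln q / pi)%:C.

Definition cexp (z : R[i]) : R[i] :=
  (expR (complex.Re z))%:C * (cos (complex.Im z) +i* sin (complex.Im z)).

Definition t12 l m n : 'M[R[i]]_(l.+1 * m.+1 * n.+1) :=
  2^-1 *: (Tsym R l m *t 1%:M).
Definition t23 l m n : 'M[R[i]]_(l.+1 * m.+1 * n.+1) :=
  2^-1 *: assoc_mx (1%:M *t Tsym R m n).

(* a^(c A) *)
Definition rpow_mx (a : R) (c : R[i]) d (A : 'M[R[i]]_d) : 'M[R[i]]_d :=
  fun_mx (fun z => cexp (c * (ln a)%:C * z)) A.

Definition is_derive_mx d (G : R -> 'M[R[i]]_d) (x : R) (D : 'M[R[i]]_d) : Prop :=
  forall i j,
    is_derive x 1 (fun y => complex.Re (G y i j)) (complex.Re (D i j)) /\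
    is_derive x 1 (fun y => complex.Im (G y i j)) (complex.Im (D i j)).

Definition is_KZ_solution (q : R) l m n
    (a : R) (G : R -> 'M[R[i]]_(l.+1 * m.+1 * n.+1)) : Prop :=
  G a = 1%:M /\
  forall x, 0 < x < 1 ->
    is_derive_mx G x
      (hbar q *: ((x^-1)%:C *: t12 l m n + ((x - 1)^-1)%:C *: t23 l m n) *m G x).

Definition is_KZ_associator (q : R) l m n
    (Phi : 'M[R[i]]_(l.+1 * m.+1 * n.+1)) : Prop :=
  exists G : R -> R -> 'M[R[i]]_(l.+1 * m.+1 * n.+1),
    (forall a, 0 < a < 1 -> is_KZ_solution q a (G a)) /\
    let Psi a := rpow_mx a (- hbar q) (t23 l m n) *m G a (1 - a) *m
                 rpow_mx a (hbar q) (t12 l m n) in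
    forall i j,
      (fun a => complex.Re (Psi a i j)) @ 0^'+ --> complex.Re (Phi i j) /\
      (fun a => complex.Im (Psi a i j)) @ 0^'+ --> complex.Im (Phi i j).

Definition is_coproduct_q (q : R) := is_coproduct (@piq R q) (@piq2 R q).
Definition is_coproduct_cl := is_coproduct (@xgen R) (@Dxgen R).

Record is_twist (q : R) (F : blocks2 R) : Prop := IsTwist {
  twist_unitary : forall n m, F n m \is unitarymx ;
  twist_coproduct : forall (x : blocks R) (X Y : blocks2 R),
    bounded_blocks x -> is_coproduct_q q x X -> is_coproduct_cl x Y ->
    forall n m, X n m = F n m *m Y n m *m (F n m)^t* ;
  (* epsilon is the component n = 0 *)
  twist_counit_l : forall m, F 0 m = 1%:M ;
  twist_counit_r : forall n, F n 0 = 1%:M ;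
  twist_Rmx : forall n m,
    (Rmx q n m)^t* *m Rmx q n m = F n m *m qpow_mx q (Tsym R n m) *m (F n m)^t* ;
  twist_associator : forall DF FsD,
    is_coproduct_l (@xgen R) (@Dxgen R) F DF ->
    is_coproduct_r (@xgen R) (@Dxgen R) (fun n m => (F n m)^t*) FsD ->
    forall l m n, is_KZ_associator q
      (assoc_mx (FsD l m n) *m assoc_mx (1%:M *t (F m n)^t*) *m
       (F l m *t 1%:M) *m DF l m n)
}.

End Twist.

Section FunctionAlgebra.
Variable R : realType.
Variable q : R.

(* sum_{n < N} sum_{i,j} (c n i j) t^l_{i,j}, with l = n/2, as a functional
   on U_q(su_2). *)
Definition coeff_fun (N : nat) (c : blocks R) : Uq R -> R[i] :=
  fun a => \sum_(n < N) \sum_(i < n.+1) \sum_(j < n.+1) c n i j * piq q a n i j.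

Definition CSUq2 : set (Uq R -> R[i]) :=
  [set t | exists N c, t = coeff_fun N c].

Definition fmul (t s : Uq R -> R[i]) : Uq R -> R[i] :=
  fun a => \sum_(p <- Ucoprod a) t p.1 * s p.2.
Definition fone : Uq R -> R[i] := @Ucounit R.
Definition fstar (t : Uq R -> R[i]) : Uq R -> R[i] :=
  fun a => Num.conj (t (Ustar (Uantipode q a))).

(* The last two fields are (h (x) id) Delta t = h(t) 1 = (id (x) h) Delta t,
   evaluated at a, where (Delta t)(b (x) a) = t(ba). *)
Record is_haar_state (h : (Uq R -> R[i]) -> R[i]) : Prop := IsHaarState {
  haar_linear : forall c t s, CSUq2 t -> CSUq2 s ->
    h (fun a => c * t a + s a) = c * h t + h s ;
  haar_positive : forall t, CSUq2 t -> 0 <= h (fmul (fstar t) t) ;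
  haar_normalized : h fone = 1 ;
  haar_invariant_l : forall t a, CSUq2 t ->
    h (fun b => t (Umul b a)) = h t * fone a ;
  haar_invariant_r : forall t a, CSUq2 t ->
    h (fun b => t (Umul a b)) = h t * fone a
}.

(* iota exhibits H as the completion of C[SU_q(2)] for <t, s> = h(t^* s).
   The form dot is linear in its first argument: <t, s> is dot s t. *)
Record is_L2 (h : (Uq R -> R[i]) -> R[i]) (H : completeNormedModType R[i])
    (dot : {dot H for @Num.conj R[i]})
    (iota : (Uq R -> R[i]) -> H) : Prop := IsL2 {
  L2_norm : forall v : H, `|v| ^+ 2 = dot v v ;
  L2_linear : forall c t s, CSUq2 t -> CSUq2 s ->
    iota (fun a => c * t a + s a) = c *: iota t + iota s ;
  L2_dot : forall t s, CSUq2 t -> CSUq2 s ->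
    dot (iota s) (iota t) = h (fmul (fstar t) s) ;
  L2_dense : dense (iota @` CSUq2)
}.

End FunctionAlgebra.

Section Dirac.
Variable R : realType.

(* Elements of C[SU_q(2)] (x) V_{1/2} are pairs of coefficient families
   (c 0, c 1), the components along |1/2,1/2> and |1/2,-1/2>.  As
   d(x)(<l,m| (x) v) = <l,m| (x) pi_l(x) v, the operator d(x) multiplies
   coefficient matrices on the right by the transpose of x. *)
Definition dpartial (x : blocks R) (c : blocks R) : blocks R :=
  fun n => c n *m (x n)^T.

Definition spinor_op (X : 'I_2 -> 'I_2 -> blocks R) (c : 'I_2 -> blocks R) :
    'I_2 -> blocks R :=
  fun a n => \sum_(b < 2) dpartial (X a b) (c b) n.

Definition algDirac_mx (q : R) (a b : 'I_2) : Uq R :=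
  match val a, val b with
  | 0, 0 => Uadd (Umul (Ue R) (Uf R)) (Uscale (- q ^- 2)%:C (Umul (Uf R) (Ue R)))
  | 0, _ => Uscale (q `^ (- 2^-1) * qnum q 2)%:C (Umul (Uki R) (Uf R))
  | _, 0 => Uscale (q `^ (2^-1) * qnum q 2)%:C (Umul (Uki R) (Ue R))
  | _, _ => Uadd (Uscale (- q ^+ 2)%:C (Umul (Ue R) (Uf R))) (Umul (Uf R) (Ue R))
  end.

Definition algDirac (q : R) : 'I_2 -> 'I_2 -> blocks R :=
  fun a b => piq q (algDirac_mx q a b).

(* The entry (a, b) is the block of (id (x) pi_{1/2})(F T F* ) at the matrix
   unit |a><b| of V_{1/2}. *)
Definition geomDirac_tilde (F : blocks2 R) : 'I_2 -> 'I_2 -> blocks R :=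
  fun a b n => \matrix_(i, j)
    (F n 1 *m Tsym R n 1 *m (F n 1)^t*) (mxtens_index (i, a)) (mxtens_index (j, b)).

Variables (H : completeNormedModType R[i]) (iota : (Uq R -> R[i]) -> H).

Definition spinor_of (q : R) (N : nat) (c : 'I_2 -> blocks R) : H * H :=
  (iota (coeff_fun q N (c 0)), iota (coeff_fun q N (c 1))).

(* Graph of the operator X on the domain C[SU_q(2)] (x) V_{1/2}. *)
Definition core_graph (q : R) (X : 'I_2 -> 'I_2 -> blocks R) :
    set ((H * H) * (H * H)) :=
  [set p | exists N c,
     p.1 = spinor_of q N c /\ p.2 = spinor_of q N (spinor_op X c)].

(* <u, v> on H (x) V_{1/2}, linear in v. *)
Definition spinor_ip (dot : {dot H for @Num.conj R[i]}) (u v : H * H) : R[i] :=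
  dot v.1 u.1 + dot v.2 u.2.

End Dirac.

Section FunctionalCalculus.
Variable R : realType.
Variables (K : lmodType R[i]) (ip : K -> K -> R[i]).

(* Projection-valued Borel measures on the line; [pvm_mass v] is the positive
   measure B |-> <v, E(B) v>. *)
Record spectral_measure := SpectralMeasure {
  pvm :> set R -> K -> K ;
  pvm_mass : K -> {measure set (measurableTypeR R) -> \bar R} ;
  pvm_linear : forall (B : set (measurableTypeR R)) c u v, measurable B ->
    pvm B (c *: u + v) = c *: pvm B u + pvm B v ;
  pvm_self_adjoint : forall (B : set (measurableTypeR R)) u v, measurable B ->
    ip u (pvm B v) = ip (pvm B u) v ;
  pvm_inter : forall (A B : set (measurableTypeR R)) v,
    measurable A -> measurable B -> pvm A (pvm B v) = pvm (A `&` B) v ;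
  pvm_full : forall v, pvm setT v = v ;
  pvm_massE : forall (B : set (measurableTypeR R)) v, measurable B ->
    pvm_mass v B = (complex.Re (ip v (pvm B v)))%:E
}.

Variable E : spectral_measure.

Definition in_domain (f : R -> R) (v : K) : Prop :=
  (\int[pvm_mass E v]_x ((f x) ^+ 2)%:E < +oo)%E.

(* The integral of f against B |-> <u, E(B) v>, by polarization. *)
Definition spectral_integral (f : R -> R) (u v : K) : R[i] :=
  4^-1 * \sum_(k < 4)
    (Num.conj 'i%C) ^+ k * (\int[pvm_mass E (u + ('i%C ^+ k) *: v)]_x f x)%:C.

(* Graph of the operator f(A) = int f dE on its maximal domain. *)
Definition fun_calc (f : R -> R) : set (K * K) :=
  [set p | in_domain f p.1 /\
     forall u, in_domain f u -> ip u p.2 = spectral_integral f u p.1].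

End FunctionalCalculus.

(* Main.v *)
Require Import Defs.
From HB Require Import structures.
From mathcomp Require Import all_boot all_order all_algebra.
From mathcomp Require Import mxtens complex.
From mathcomp Require Import finmap.
From mathcomp Require Import all_classical all_reals all_analysis.
From mathcomp Require Import measurable_realfun.
From mathcomp Require Import ring lra.

Set Implicit Arguments.
Unset Strict Implicit.
Unset Printing Implicit Defensive.

Import Order.TTheory GRing.Theory Num.Theory.
Import numFieldNormedType.Exports.
Local Open Scope classical_set_scope.
Local Open Scope ring_scope.
Local Open Scope complex_scope.

(** The statement compares two unbounded operators: the closure of the algebraic Dirac
    operator on its core, and [A] = (q^A - q^(-A))/(q - q^-1), formed by the spectral
    theorem from the closure A of the geometric operator.

    On one block V_l (x) V_(1/2) the comparison is algebra. The twist satisfies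
    F q^T F^* = R^* R, and on a spin 1/2 factor the R-matrix is a lower triangular 2 x 2
    matrix over the operators on V_l, with diagonal entries k and k^-1 and lower entry a
    multiple of e. Its inverse is equally explicit, and
    (R^* R - (R^* R)^-1)/(q - q^-1) turns out to be the matrix of the algebraic Dirac
    operator ([algDirac_blk]). Hence an eigenbasis of F T F^* with eigenvalues d is an
    eigenbasis of the algebraic operator with eigenvalues [d] ([dirac_diag]), and every
    vector of the core is a finite sum of common eigenvectors.

    The rest is spectral theory. A vector c with A c = l c lies in the range of the
    spectral projection of the point l ([eigenvector]), so that q^A and q^(-A) act on the
    core as expected, and their graphs are closed ([fun_calc_eigensum],
    [fun_calc_closure]). For x in the core,
    |q^A x|^2 + |q^(-A) x|^2 = |(q - q^-1) [A] x|^2 + 2 |x|^2: if x and [A] x converge,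
    then so do q^A x and q^(-A) x, which is one inclusion ([closure_sub_qnum]). For the
    other one, [A] + i maps the core onto itself, since it acts on eigenvectors by nonzero
    factors; so it has dense range, and symmetry of [A] on the larger domain then shows
    that the core is dense in it for the graph norm ([qnum_sub_closure]). *)


(** * Real inner products and norms *)

Section RealInnerProduct.
Variables (R : realType) (K : lmodType R[i]) (dot : {dot K for @Num.conj R[i]}).

(** The real part of the inner product. Estimates are real this way; the imaginary
    part comes back through multiplication by i, see [Im_dot]. *)
Definition rdot (u v : K) : R := complex.Re (dot v u).
Definition hnorm (u : K) : R := Num.sqrt (rdot u u).

Lemma ReD (x y : R[i]) : complex.Re (x + y) = complex.Re x + complex.Re y.
Proof. by case: x; case: y. Qed.

Lemma ReN (x : R[i]) : complex.Re (- x) = - complex.Re x.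
Proof. by case: x. Qed.

Lemma ReZ (a : R) (x : R[i]) : complex.Re (a%:C * x) = a * complex.Re x.
Proof. by case: x => x y /=; rewrite mul0r subr0. Qed.

Lemma Re_sum (I : Type) (s : seq I) (f : I -> R[i]) :
  complex.Re (\sum_(i <- s) f i) = \sum_(i <- s) complex.Re (f i).
Proof. by elim: s => [|i s IH]; rewrite ?big_nil // !big_cons ReD IH. Qed.

Lemma conjcE (x : R[i]) : Num.conj x = conjc x.
Proof. by case: x. Qed.

Lemma dotC u v : dot u v = Num.conj (dot v u).
Proof. by rewrite hermC expr0 mul1r. Qed.

Lemma rdotC u v : rdot u v = rdot v u.
Proof. by rewrite /rdot dotC conjcE; case: (dot u v). Qed.

Lemma rdotDr u v w : rdot u (v + w) = rdot u v + rdot u w.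
Proof. by rewrite /rdot linearDl ReD. Qed.

Lemma rdotNr u v : rdot u (- v) = - rdot u v.
Proof. by rewrite /rdot linearNl ReN. Qed.

Lemma rdotBr u v w : rdot u (v - w) = rdot u v - rdot u w.
Proof. by rewrite rdotDr rdotNr. Qed.

Lemma rdotZr (a : R) u v : rdot u (a%:C *: v) = a * rdot u v.
Proof. by rewrite /rdot linearZl_LR /= ReZ. Qed.

Lemma rdotDl u v w : rdot (v + w) u = rdot v u + rdot w u.
Proof. by rewrite rdotC rdotDr !(rdotC u). Qed.

Lemma rdotNl u v : rdot (- v) u = - rdot v u.
Proof. by rewrite rdotC rdotNr rdotC. Qed.

Lemma rdotBl u v w : rdot (v - w) u = rdot v u - rdot w u.
Proof. by rewrite rdotDl rdotNl. Qed.

Lemma rdotZl (a : R) u v : rdot (a%:C *: v) u = a * rdot v u.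
Proof. by rewrite rdotC rdotZr rdotC. Qed.

Lemma rdot0r u : rdot u 0 = 0.
Proof. by rewrite -(subrr u) rdotBr subrr. Qed.

Lemma Im_dot u v : complex.Im (dot v u) = rdot ('i%C *: u) v.
Proof.
rewrite /rdot linearZr_LR /= conjcE; case: (dot v u) => a b /=.
by rewrite mul0r mulN1r opprK add0r.
Qed.

Lemma rdot_ge0 u : 0 <= rdot u u.
Proof. by have := dnorm_ge0 dot u; rewrite lecE => /andP[]. Qed.

Lemma rdot_eq0 u : rdot u u = 0 -> u = 0.
Proof.
move=> u0; apply/eqP; rewrite -(dnorm_eq0 dot) eq_complex.
by rewrite -/(rdot u u) u0 (ger0_Im (dnorm_ge0 dot u)) /= !eqxx.
Qed.

Lemma hnorm_ge0 u : 0 <= hnorm u. Proof. exact: sqrtr_ge0. Qed.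
Hint Resolve hnorm_ge0 : core.

Lemma hnorm_sqr u : hnorm u ^+ 2 = rdot u u.
Proof. by rewrite sqr_sqrtr ?rdot_ge0. Qed.

Lemma hnorm0 : hnorm 0 = 0.
Proof. by rewrite /hnorm rdot0r sqrtr0. Qed.

Lemma hnormN u : hnorm (- u) = hnorm u.
Proof. by rewrite /hnorm rdotNl rdotNr opprK. Qed.

Lemma hnormBC u v : hnorm (u - v) = hnorm (v - u).
Proof. by rewrite -hnormN opprB. Qed.

Lemma hnormZ (a : R) u : hnorm (a%:C *: u) = `|a| * hnorm u.
Proof.
rewrite /hnorm rdotZl rdotZr mulrA -expr2 sqrtrM ?sqr_ge0 //.
by rewrite sqrtr_sqr.
Qed.

Lemma hnormi u : hnorm ('i%C *: u) = hnorm u.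
Proof.
rewrite /hnorm /rdot linearZl_LR linearZr_LR /= conjcE.
case: (dot u u) => a b /=; congr Num.sqrt; ring.
Qed.

Lemma cauchy_schwarz u v : `|rdot u v| <= hnorm u * hnorm v.
Proof.
suff H : (rdot u v) ^+ 2 <= rdot u u * rdot v v.
  by rewrite -sqrtr_sqr -sqrtrM ?rdot_ge0 // ler_wsqrtr.
have [v0|v0] := eqVneq (rdot v v) 0.
  by rewrite (rdot_eq0 v0) !rdot0r expr2 !mulr0.
have vp : 0 < rdot v v by rewrite lt_def v0 rdot_ge0.
have := rdot_ge0 ((rdot v v)%:C *: u - (rdot u v)%:C *: v).
rewrite !rdotBr !rdotBl !rdotZl !rdotZr (rdotC v u).
set a := rdot u u; set b := rdot u v; set c := rdot v v => H.
have : 0 <= c * (a * c - b ^+ 2) by move: H; congr (_ <= _); ring.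
by rewrite pmulr_rge0 // subr_ge0.
Qed.

Lemma hnormD u v : hnorm (u + v) <= hnorm u + hnorm v.
Proof.
rewrite -(@ler_pXn2r _ 2) ?nnegrE ?addr_ge0 // hnorm_sqr.
rewrite sqrrD !hnorm_sqr !rdotDr !rdotDl (rdotC v u).
have := le_trans (ler_norm _) (cauchy_schwarz u v).
by rewrite mulr2n; lra.
Qed.

Lemma hnorm_dist u v w : hnorm (u - w) <= hnorm (u - v) + hnorm (v - w).
Proof. by have := hnormD (u - v) (v - w); rewrite addrA subrK. Qed.

Lemma hnorm_sum (I : Type) (s : seq I) (f : I -> K) :
  hnorm (\sum_(i <- s) f i) <= \sum_(i <- s) hnorm (f i).
Proof.
elim: s => [|i s IH]; first by rewrite !big_nil hnorm0.
by rewrite !big_cons (le_trans (hnormD _ _)) // lerD2l.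
Qed.

End RealInnerProduct.
#[global] Hint Extern 0 (is_true (0 <= hnorm _ _)) => exact: hnorm_ge0 : core.

(** * Spectral measures and simple functions *)

Section SpectralMeasure.
Variables (R : realType) (K : lmodType R[i]) (dot : {dot K for @Num.conj R[i]}).
Variable E : spectral_measure (fun u v : K => dot v u).
Local Notation T := (measurableTypeR R).
Local Notation N := (hnorm dot).

Implicit Types (A B : set T) (u v : K).

Lemma pvmD B u v : measurable B -> pvm E B (u + v) = pvm E B u + pvm E B v.
Proof. by move=> mB; have := pvm_linear E 1 u v mB; rewrite !scale1r. Qed.

Lemma pvm0 B : measurable B -> pvm E B 0 = 0.
Proof.
move=> mB; have := pvmD 0 0 mB; rewrite addr0.
by move/(congr1 (fun x => x - pvm E B 0)); rewrite subrr addrK.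
Qed.

Lemma pvmZ B c u : measurable B -> pvm E B (c *: u) = c *: pvm E B u.
Proof. by move=> mB; have := pvm_linear E c u 0 mB; rewrite pvm0 // !addr0. Qed.

Lemma pvm_dot A B u v : measurable A -> measurable B ->
  dot (pvm E B v) (pvm E A u) = dot (pvm E (A `&` B) v) u.
Proof.
move=> mA mB; rewrite -(pvm_inter E _ mA mB); symmetry.
exact: (pvm_self_adjoint E u (pvm E B v) mA).
Qed.

(** [E B] is a self-adjoint idempotent. *)
Lemma pvm_massN B v : measurable B -> pvm_mass E v B = ((N (pvm E B v)) ^+ 2)%:E.
Proof.
by move=> mB; rewrite pvm_massE // hnorm_sqr /rdot pvm_dot // setIid.
Qed.

Lemma pvm_massT v : pvm_mass E v setT = ((N v) ^+ 2)%:E.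
Proof. by rewrite pvm_massN // pvm_full. Qed.

Lemma pvm_eq0 B v : measurable B -> pvm_mass E v B = 0%E -> pvm E B v = 0.
Proof.
move=> mB; rewrite pvm_massN // hnorm_sqr => -[/rdot_eq0]; exact.
Qed.

Lemma pvm_set0 v : pvm E set0 v = 0.
Proof. by apply: pvm_eq0 => //; rewrite measure0. Qed.

Lemma pvm_disjoint A B u v : measurable A -> measurable B -> A `&` B = set0 ->
  dot (pvm E B v) (pvm E A u) = 0.
Proof. by move=> mA mB AB; rewrite pvm_dot // AB pvm_set0 linear0l. Qed.

Lemma hnorm_pvm B v : measurable B -> N (pvm E B v) <= N v.
Proof.
move=> mB; rewrite -(@ler_pXn2r _ 2) ?nnegrE //.
have : (pvm_mass E v B <= pvm_mass E v setT)%E by rewrite le_measure ?inE.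
by rewrite pvm_massN // pvm_massT lee_fin.
Qed.

Lemma pvm_mass_fin B v : measurable B -> (pvm_mass E v B < +oo)%E.
Proof. by move=> mB; rewrite pvm_massN // ltry. Qed.

Import HBNNSimple.

(** The operator int s dE of a simple function s. *)
Definition simple_op (s : {nnsfun T >-> R}) (v : K) : K :=
  \sum_(a <- fset_set (range s)) a%:C *: pvm E (s @^-1` [set a]) v.

Lemma measurable_simple_fiber (s : {nnsfun T >-> R}) a : measurable (s @^-1` [set a] : set T).
Proof. exact: measurable_funPTI. Qed.
Hint Resolve measurable_simple_fiber : core.

Lemma simple_op_linear s c u v :
  simple_op s (c *: u + v) = c *: simple_op s u + simple_op s v.
Proof.
rewrite /simple_op scaler_sumr -big_split /=; apply: eq_bigr => a _.
by rewrite pvm_linear // scalerDr !scalerA mulrC.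
Qed.

Lemma simple_opD s u v : simple_op s (u + v) = simple_op s u + simple_op s v.
Proof. by have := simple_op_linear s 1 u v; rewrite !scale1r. Qed.

Lemma simple_op0 s : simple_op s 0 = 0.
Proof. by rewrite /simple_op big1 // => a _; rewrite pvm0 ?scaler0. Qed.

Lemma simple_opZ s c u : simple_op s (c *: u) = c *: simple_op s u.
Proof. by rewrite -[c *: u]addr0 simple_op_linear simple_op0 addr0. Qed.

Lemma simple_opB s u v : simple_op s (u - v) = simple_op s u - simple_op s v.
Proof. by rewrite -scaleN1r addrC simple_op_linear scaleN1r addrC. Qed.

Lemma simple_op_adj s u v : dot (simple_op s v) u = dot v (simple_op s u).
Proof.
rewrite /simple_op linear_sumlz linear_sumr /=; apply: eq_bigr => a _.
rewrite linearZl_LR linearZr_LR /= conjcE conjc_real; congr (_ * _).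
exact: (pvm_self_adjoint E u v).
Qed.

(** Among the fibers of [s], only the one through [l] meets the point [l] which
    carries [x]. *)
Lemma simple_op_eigen s l x : pvm E [set l] x = x -> simple_op s x = (s l)%:C *: x.
Proof.
move=> Ex; rewrite /simple_op.
have mem : s l \in fset_set (range s) by rewrite in_fset_set // inE; exists l.
rewrite (big_rem _ mem) /= big1_seq => [|a /= ].
  rewrite addr0 -{1}Ex pvm_inter // setIidr => [|y /= ->//].
  by rewrite Ex.
rewrite mem_rem_uniq ?fset_uniq // inE /= => /andP[al _].
rewrite -{1}Ex pvm_inter //.
suff -> : s @^-1` [set a] `&` [set l] = set0 by rewrite pvm_set0 scaler0.
by apply/seteqP; split => // y [/= + yl]; rewrite yl => la; rewrite la eqxx in al.
Qed.

Lemma integral_simple (mu : {measure set T -> \bar R}) (s : {nnsfun T >-> R})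
    (g : R -> R) : (forall a, 0 <= a -> 0 <= g a) ->
  (\int[mu]_x (g (s x))%:E =
   \sum_(a <- fset_set (range s)) (g a)%:E * mu (s @^-1` [set a]))%E.
Proof.
move=> g0.
have sE x : (g (s x))%:E =
    (\sum_(a <- fset_set (range s)) (g `|a|)%:E * (\1_(s @^-1` [set a]) x)%:E)%E.
  (* the absolute value makes the summand nonnegative for every real index a *)
  have mem : s x \in fset_set (range s) by rewrite in_fset_set // inE; exists x.
  rewrite (big_rem _ mem) /= big1_seq => [|a /= ].
    by rewrite adde0 indicE mem_set // mule1 ger0_norm.
  rewrite mem_rem_uniq ?fset_uniq // inE /= => /andP[al _].
  rewrite indicE memNset ?mule0 // => /= xa; rewrite xa eqxx // in al.
under eq_integral do rewrite sE.
rewrite ge0_integral_sum //=; last 2 first.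
- move=> a; apply/measurable_EFinP; apply: measurable_funM => //.
- by move=> a x _; rewrite -EFinM lee_fin mulr_ge0 ?g0.
apply: eq_big_seq => a; rewrite in_fset_set // inE => -[x _ <-].
rewrite ge0_integralZl //; last 2 first.
- exact/measurable_EFinP.
- by rewrite lee_fin g0.
by rewrite integral_indic // setIT ger0_norm.
Qed.

Lemma integral_simple1 (s : {nnsfun T >-> R}) v :
  (\int[pvm_mass E v]_x (s x)%:E = (rdot dot v (simple_op s v))%:E)%E.
Proof.
rewrite (integral_simple _ s (g := id)) // /rdot /simple_op linear_sumlz.
rewrite Re_sum -sumEFin; apply: eq_bigr => a _.
by rewrite pvm_massE // linearZl_LR /= ReZ EFinM.
Qed.

(** Distinct fibers of [s] give orthogonal ranges of E, so the cross terms of the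
    norm vanish. *)
Lemma integral_simple2 (s : {nnsfun T >-> R}) v :
  (\int[pvm_mass E v]_x ((s x) ^+ 2)%:E = ((N (simple_op s v)) ^+ 2)%:E)%E.
Proof.
rewrite (integral_simple _ s (g := fun a => a ^+ 2)); last by move=> a _; exact: sqr_ge0.
rewrite hnorm_sqr /rdot {1}/simple_op linear_sumlz.
rewrite Re_sum -sumEFin; apply: eq_big_seq => a aS.
rewrite linearZl_LR /= ReZ.
rewrite /simple_op linear_sumr /= (big_rem _ aS) /= big1_seq ?addr0 => [|b /=].
  rewrite linearZr_LR /= conjcE conjc_real pvm_dot // setIid ReZ mulrA -expr2.
  by rewrite EFinM pvm_massE.
rewrite mem_rem_uniq ?fset_uniq // inE /= => /andP[al _].
rewrite linearZr_LR /= pvm_disjoint ?mulr0 //.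
by apply/seteqP; split => // y [/= -> ba]; rewrite ba eqxx in al.
Qed.

Lemma hnorm_simple_op s : exists2 C, 0 <= C & forall v, N (simple_op s v) <= C * N v.
Proof.
exists (\sum_(a <- fset_set (range s)) `|a|); first exact: sumr_ge0.
move=> v; rewrite (le_trans (hnorm_sum _ _ _)) // mulr_suml ler_sum // => a _.
by rewrite hnormZ ler_wpM2l // hnorm_pvm.
Qed.

End SpectralMeasure.

(** * Approximation of a function by simple functions *)

Section SimpleApprox.
Import HBNNSimple.
Variables (R : realType) (f : R -> R).
Local Notation T := (measurableTypeR R).
Hypotheses (mf : measurable_fun [set: T] (f : T -> R)) (f0 : forall x, 0 <= f x).

Let mEf : measurable_fun [set: T] (EFin \o f : T -> \bar R).
Proof. exact/measurable_EFinP. Qed.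

Definition sapprox : {nnsfun T >-> R}^nat := nnsfun_approx measurableT mEf.

Lemma sapprox_ge0 n x : 0 <= sapprox n x.
Proof. exact: fun_ge0. Qed.

Lemma sapprox_nd m n x : (m <= n)%N -> sapprox m x <= sapprox n x.
Proof. by move=> mn; have /lefP := nd_nnsfun_approx measurableT mEf mn; apply. Qed.

Lemma sapprox_le n x : sapprox n x <= f x.
Proof.
rewrite -lee_fin /sapprox nnsfun_approxE.
by apply: (le_approx (D := setT) (f := EFin \o f : T -> \bar R)) => // y _ /=; rewrite lee_fin.
Qed.

Lemma sapprox_cvg x : sapprox n x @[n --> \oo] --> f x.
Proof.
have := @cvg_nnsfun_approx _ T R setT measurableT _ mEf.
move=> /(_ _ x I); rewrite -/sapprox => H.
have /fine_cvgP [_ //] : EFin \o sapprox^~ x @ \oo --> (f x)%:E.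
by apply: H => y _ /=; rewrite lee_fin.
Qed.

(** Monotone convergence; needed for the identity and for the square. *)
Lemma integral_sapprox_cvg (mu : {measure set T -> \bar R}) (g : R -> R) :
    continuous g -> (forall a, 0 <= a -> 0 <= g a) ->
    (forall a b, 0 <= a -> a <= b -> g a <= g b) ->
  (\int[mu]_x (g (sapprox n x))%:E @[n --> \oo] --> \int[mu]_x (g (f x))%:E)%E.
Proof.
move=> cg g0 gm.
have mg : measurable_fun [set: R] g by exact: continuous_measurable_fun.
have -> : (\int[mu]_x (g (f x))%:E = \int[mu]_x (limn (fun n => (g (sapprox n x))%:E)))%E.
  apply: eq_integral => x _; apply/esym/cvg_lim => //.
  apply: cvg_EFin; first exact: nearW.
  by apply: continuous_cvg; [exact: cg | exact: sapprox_cvg].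
apply: cvg_monotone_convergence => //.
- move=> n; apply/measurable_EFinP; apply: measurableT_comp => //.
- by move=> n x _; rewrite lee_fin g0 // sapprox_ge0.
- by move=> x _ m n mn; rewrite lee_fin gm ?sapprox_ge0 // sapprox_nd.
Qed.

End SimpleApprox.

(** * Domains and spectral integrals of nonnegative functions *)

(** Real and imaginary part of the polarization formula in [spectral_integral]. *)
Lemma polar_sum (R : realType) (r : nat -> R) :
  4^-1 * \sum_(k < 4) (Num.conj ('i%C : R[i])) ^+ k * (r k)%:C =
  (4^-1 * (r 0%N - r 2%N)) +i* (4^-1 * (r 3%N - r 1%N)).
Proof.
have -> : (4^-1 : R[i]) = (4^-1)%:C by rewrite fmorphV rmorph_nat.
rewrite !big_ord_recl big_ord0 conjcE /= /bump /= !exprS expr0 !mulr1.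
by apply/eqP; rewrite eq_complex /=; apply/andP; split; apply/eqP; ring.
Qed.

Section DomainOfFunction.
Import HBNNSimple.
Variables (R : realType) (K : lmodType R[i]) (dot : {dot K for @Num.conj R[i]}).
Variable E : spectral_measure (fun u v : K => dot v u).
Variable f : R -> R.
Local Notation T := (measurableTypeR R).
Local Notation N := (hnorm dot).
Local Notation "u \dot v" := (rdot dot u v) (at level 40).
Hypotheses (mf : measurable_fun [set: T] (f : T -> R)) (f0 : forall x, 0 <= f x).

Local Notation S n := (simple_op E (sapprox mf n)).
Implicit Types u v w : K.

Lemma hnorm_sapprox_cvg v :
  (((N (S n v)) ^+ 2)%:E @[n --> \oo] --> \int[pvm_mass E v]_x ((f x) ^+ 2)%:E)%E.
Proof.
under eq_fun do rewrite -integral_simple2.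
apply: (integral_sapprox_cvg mf f0 (g := fun a => a ^+ 2)).
- by move=> x; exact: exprn_continuous.
- by move=> a _; exact: sqr_ge0.
- by move=> a b a0 ab; rewrite ler_pXn2r // nnegrE // (le_trans a0).
Qed.

Lemma hnorm_sapprox_nd m n v : (m <= n)%N -> N (S m v) <= N (S n v).
Proof.
move=> mn; rewrite -(@ler_pXn2r _ 2) ?nnegrE // -lee_fin -!integral_simple2.
apply: ge0_le_integral => //.
- by move=> x _; rewrite lee_fin sqr_ge0.
- by apply/measurable_EFinP; apply: measurable_funX.
- by apply/measurable_EFinP; apply: measurable_funX.
- by move=> x _; rewrite lee_fin ler_pXn2r ?nnegrE ?sapprox_ge0 ?sapprox_nd.
Qed.

(** By monotone convergence the integral of f^2 against the mass of v is the
    increasing limit of the |S n v|^2. In this form the domain is visibly a linear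
    subspace, and vectors can be put into it by estimates. *)
Lemma in_domainP v : in_domain E f v <-> exists M, forall n, N (S n v) <= M.
Proof.
split=> [fin|[M HM]].
  exists (Num.sqrt (fine (\int[pvm_mass E v]_x ((f x) ^+ 2)%:E)%E)) => n.
  rewrite -(ger0_norm (hnorm_ge0 dot (S n v))) -sqrtr_sqr; apply: ler_wsqrtr.
  have int0 : (0 <= \int[pvm_mass E v]_x ((f x) ^+ 2)%:E)%E.
    by apply: integral_ge0 => x _; rewrite lee_fin sqr_ge0.
  rewrite -lee_fin fineK; last by rewrite ge0_fin_numE.
  rewrite -integral_simple2; apply: ge0_le_integral => //.
  - by move=> x _; rewrite lee_fin sqr_ge0.
  - by apply/measurable_EFinP; apply: measurable_funX.
  - by apply/measurable_EFinP; apply: measurable_funX.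
  - by move=> x _; rewrite lee_fin ler_pXn2r ?nnegrE ?sapprox_ge0 ?sapprox_le.
rewrite /in_domain -(cvg_lim _ (hnorm_sapprox_cvg (v := v))) //.
apply: (@le_lt_trans _ _ (M ^+ 2)%:E); last exact: ltry.
apply: lime_le; first by apply/cvg_ex; eexists; exact: hnorm_sapprox_cvg.
apply: nearW => n; rewrite lee_fin ler_pXn2r ?nnegrE //.
exact: le_trans (HM n).
Qed.

Lemma in_domainD u v : in_domain E f u -> in_domain E f v -> in_domain E f (u + v).
Proof.
move=> /in_domainP [M HM] /in_domainP [M' HM']; apply/in_domainP.
exists (M + M') => n; rewrite simple_opD.
by rewrite (le_trans (hnormD _ _ _)) // lerD.
Qed.

Lemma in_domain_i k u : in_domain E f u -> in_domain E f ('i%C ^+ k *: u).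
Proof.
move=> /in_domainP [M HM]; apply/in_domainP; exists M => n.
rewrite simple_opZ; elim: k => [|k IH]; first by rewrite scale1r.
by rewrite exprS -scalerA hnormi.
Qed.

(** The mass of [w] is finite and f <= 1 + f^2, so that f is integrable. *)
Lemma rdot_sapprox_cvg w : in_domain E f w ->
  w \dot S n w @[n --> \oo] --> \int[pvm_mass E w]_x f x.
Proof.
move=> dw.
have fin : (\int[pvm_mass E w]_x (f x)%:E < +oo)%E.
  apply: (@le_lt_trans _ _ (\int[pvm_mass E w]_x (1 + (f x) ^+ 2)%:E)%E).
    apply: ge0_le_integral => //.
    - by move=> x _; rewrite lee_fin.
    - exact/measurable_EFinP.
    - by apply/measurable_EFinP; apply: measurable_funD => //; apply: measurable_funX.
    - by move=> x _; rewrite lee_fin; have := sqr_ge0 (f x - 1); have := f0 x; nra.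
  under eq_integral do rewrite EFinD.
  rewrite ge0_integralD //.
  - by rewrite lte_add_pinfty // integral_cst // mul1e pvm_mass_fin.
  - by move=> x _; rewrite lee_fin sqr_ge0.
  - by apply/measurable_EFinP; apply: measurable_funX.
have cid : continuous (id : R -> R) by move=> x; exact: cvg_id.
have := integral_sapprox_cvg mf f0 (mu := pvm_mass E w) cid (fun _ => id) (fun _ _ _ => id).
have fn : (\int[pvm_mass E w]_x (f x)%:E \is a fin_num)%E.
  by rewrite ge0_fin_numE //; apply: integral_ge0 => x _; rewrite lee_fin.
rewrite /= -{1}(fineK fn) => /fine_cvgP [_].
apply: cvg_trans; apply: near_eq_cvg; apply: nearW => n /=.
by rewrite integral_simple1.
Qed.

(** The spectral integral is the weak limit of the simple operators [S n]. It thus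
    inherits linearity, symmetry and the Cauchy-Schwarz inequality from them, all of
    which its definition by polarization hides. *)
Lemma spectral_integral_cvg u v : in_domain E f u -> in_domain E f v ->
  (u \dot S n v @[n --> \oo] --> complex.Re (spectral_integral E f u v)) /\
  (('i%C *: u) \dot S n v @[n --> \oo] --> complex.Im (spectral_integral E f u v)).
Proof.
move=> du dv.
pose w k := u + 'i%C ^+ k *: v.
have dw k : in_domain E f (w k) by apply: in_domainD => //; exact: in_domain_i.
have -> : spectral_integral E f u v =
    4^-1 * \sum_(k < 4) (Num.conj ('i%C : R[i])) ^+ k *
      (\int[pvm_mass E (w k)]_x f x)%:C by [].
rewrite (polar_sum (fun k => \int[pvm_mass E (w k)]_x f x)) /=.
have sym a b n : a \dot S n b = b \dot S n a.
  by rewrite /rdot simple_op_adj (dotC dot b) conjcE; case: (dot _ _).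
have w0 : w 0%N = u + v by rewrite /w expr0 scale1r.
have w2 : w 2%N = u - v by rewrite /w sqr_i scaleN1r.
have w1 : w 1%N = u + 'i%C *: v by rewrite /w expr1.
have w3 : w 3%N = u - 'i%C *: v by rewrite /w exprS sqr_i mulrN1 scaleNr.
have key a b n : 4^-1 * ((a + b) \dot S n (a + b) - (a - b) \dot S n (a - b)) = a \dot S n b.
  rewrite simple_opD simple_opB !rdotDl !rdotDr !rdotNl !rdotNr (sym b a); lra.
have iS n : ('i%C *: u) \dot S n v = 4^-1 * (w 3%N \dot S n (w 3%N) - w 1%N \dot S n (w 1%N)).
  have := key u (- ('i%C *: v)) n; rewrite opprK w3 w1 => ->.
  rewrite -scaleNr simple_opZ /rdot linearZl_LR linearZr_LR /= conjcE.
  by case: (dot _ _) => a b /=; ring.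
split.
  have -> : (fun n => u \dot S n v) =
      (fun n => 4^-1 * (w 0%N \dot S n (w 0%N) - w 2%N \dot S n (w 2%N))).
    by apply/funext => n; rewrite w0 w2 key.
  by apply: cvgMl_tmp; apply: cvgB; exact: rdot_sapprox_cvg.
rewrite (_ : (fun n => _) = (fun n => 4^-1 * (w 3%N \dot S n (w 3%N) - w 1%N \dot S n (w 1%N)))).
  by apply: cvgMl_tmp; apply: cvgB; exact: rdot_sapprox_cvg.
by apply/funext => n; rewrite iS.
Qed.

End DomainOfFunction.

(** * Functions of an operator on sums of eigenvectors *)

Section EigenLists.
Import HBNNSimple.
Variables (R : realType) (K : lmodType R[i]) (dot : {dot K for @Num.conj R[i]}).
Variable E : spectral_measure (fun u v : K => dot v u).
Local Notation T := (measurableTypeR R).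
Local Notation N := (hnorm dot).
Local Notation "u \dot v" := (rdot dot u v) (at level 40).
Implicit Types (u v w : K) (L : seq (R * K)).

(** A pair (l, x) stands for an eigenvector x with eigenvalue l. *)
Definition eigenlist L := forall p, p \in L -> pvm E [set p.1] p.2 = p.2.
(** The vector phi(A) x, where A is the operator of E and x is the sum of the
    eigenvectors in [L]; x itself is the case phi = 1. *)
Definition eigensum (phi : R -> R) L : K := \sum_(p <- L) (phi p.1)%:C *: p.2.

Lemma eigensum_cons phi p L : eigensum phi (p :: L) = (phi p.1)%:C *: p.2 + eigensum phi L.
Proof. by rewrite /eigensum big_cons. Qed.

Lemma eigensum_cat phi L1 L2 : eigensum phi (L1 ++ L2) = eigensum phi L1 + eigensum phi L2.
Proof. by rewrite /eigensum big_cat. Qed.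

Lemma eigensum_map c phi L : eigensum phi [seq (p.1, c *: p.2) | p <- L] = c *: eigensum phi L.
Proof.
rewrite /eigensum big_map scaler_sumr; apply: eq_bigr => p _ /=.
by rewrite !scalerA mulrC.
Qed.

Lemma eigenlist_cat L1 L2 : eigenlist L1 -> eigenlist L2 -> eigenlist (L1 ++ L2).
Proof. by move=> H1 H2 p; rewrite mem_cat => /orP[]; auto. Qed.

Lemma eigenlist_map c L : eigenlist L -> eigenlist [seq (p.1, c *: p.2) | p <- L].
Proof. by move=> H _ /mapP[p pL ->] /=; rewrite pvmZ // H. Qed.

Lemma simple_op_eigensum (s : {nnsfun T >-> R}) L : eigenlist L ->
  simple_op E s (eigensum (fun=> 1) L) = eigensum s L.
Proof.
elim: L => [|p L IH] H; first by rewrite /eigensum !big_nil simple_op0.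
rewrite !eigensum_cons simple_opD scale1r IH => [|r rL]; last by rewrite H // inE rL orbT.
by rewrite (@simple_op_eigen _ _ _ _ _ p.1) // H // inE eqxx.
Qed.

Lemma eigensum_cvg (phi : nat -> R -> R) psi L :
    (forall l, phi n l @[n --> \oo] --> psi l) ->
  N (eigensum (phi n) L - eigensum psi L) @[n --> \oo] --> (0 : R).
Proof.
move=> H; elim: L => [|p L IH].
  by under eq_fun do rewrite /eigensum !big_nil subrr hnorm0; exact: cvg_cst.
apply: (@squeeze_cvgr _ _ _ _ (fun=> 0)
  (fun n => `|phi n p.1 - psi p.1| * N p.2 + N (eigensum (phi n) L - eigensum psi L))).
- apply: nearW => n; rewrite hnorm_ge0 /= !eigensum_cons opprD addrACA -scalerBl -rmorphB.
  by rewrite (le_trans (hnormD _ _ _)) // hnormZ.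
- exact: cvg_cst.
- rewrite [X in _ --> X](_ : 0 = 0 * N p.2 + 0); last by rewrite mul0r addr0.
  apply: cvgD => //; apply: cvgMr_tmp.
  rewrite -(normr0 R) -(subrr (psi p.1)); apply: cvg_norm.
  by apply: cvgB => //; exact: cvg_cst.
Qed.

Variable f : R -> R.
Hypotheses (mf : measurable_fun [set: T] (f : T -> R)) (f0 : forall x, 0 <= f x).
Local Notation S n := (simple_op E (sapprox mf n)).

(** The norms |S n x| increase with n, and their limit is |f(A) x|. *)
Lemma hnorm_sapprox_eigensum n L : eigenlist L ->
  N (S n (eigensum (fun=> 1) L)) <= N (eigensum f L).
Proof.
move=> eL; apply/ler_addgt0Pr => e e0.
have := @eigensum_cvg (fun n => sapprox mf n : R -> R) f L (sapprox_cvg mf f0).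
move=> /cvgrPdist_lt /(_ _ e0) [m _ Hm].
have := Hm (maxn m n) (leq_maxl _ _).
rewrite /= sub0r normrN ger0_norm // => /ltW {}Hm.
apply: (le_trans (hnorm_sapprox_nd E mf _ (leq_maxr m n))).
rewrite simple_op_eigensum //; set y := eigensum _ L.
by rewrite -[y](subrK (eigensum f L)) (le_trans (hnormD _ _ _)) // addrC lerD2l.
Qed.

(** The operator f(A) is closed, as far as limits of eigenvector sums are concerned.
    The limit [v] is in the domain because |S n x| <= |f(A) x| uniformly in n, and for u
    in the domain, S n u stays bounded, which makes the convergence of u . S n x to
    u . f(A) x uniform enough to pass to the limit [v]. *)
Lemma fun_calc_closure v w :
    (forall e, 0 < e -> exists L, [/\ eigenlist L,
       N (eigensum (fun=> 1) L - v) < e & N (eigensum f L - w) < e]) ->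
  fun_calc E f (v, w).
Proof.
move=> H.
have dv : in_domain E f v.
  apply/(in_domainP E mf f0); exists (N w + 1 + 1) => n.
  have [C C0 HC] := hnorm_simple_op E (sapprox mf n).
  have e0 : 0 < (C + 1)^-1 by rewrite invr_gt0 ltr_wpDl.
  have [L [eL /ltW Lv /ltW Lw]] := H _ e0.
  (* an error below 1/(C+1) changes the norms of S n v and of w by at most 1 each *)
  have e1 : (C + 1)^-1 <= 1 by rewrite invf_le1 ?lerDr // ltr_wpDl.
  have -> : v = eigensum (fun=> 1) L - (eigensum (fun=> 1) L - v) by rewrite subKr.
  rewrite simple_opB (le_trans (hnormD _ _ _)) // hnormN lerD //.
    rewrite (le_trans (hnorm_sapprox_eigensum n eL)) // -[eigensum f L](subrK w).
    by rewrite (le_trans (hnormD _ _ _)) // addrC lerD2l (le_trans Lw).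
  rewrite (le_trans (HC _)) // (le_trans (ler_wpM2l C0 Lv)) //.
  by rewrite ler_pdivrMr ?ltr_wpDl // mul1r lerDl.
have key u : in_domain E f u -> u \dot S n v @[n --> \oo] --> u \dot w.
  move=> /(in_domainP E mf f0) [M HM].
  have M0 : 0 <= M by exact: le_trans (hnorm_ge0 _ _) (HM 0%N).
  have Nu0 := hnorm_ge0 dot u.
  apply/cvgrPdist_lt => e e0.
  have d0 : 0 < e / (3 * (M + N u + 1)) by rewrite divr_gt0 // mulr_gt0 // ltr_wpDl ?addr_ge0.
  set d := e / _ in d0.
  have [L [eL /ltW Lv /ltW Lw]] := H _ d0.
  have := @eigensum_cvg (fun n => sapprox mf n : R -> R) f L (sapprox_cvg mf f0).
  move=> /cvgrPdist_lt /(_ _ d0); apply: filterS => n /=.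
  rewrite sub0r normrN ger0_norm // -simple_op_eigensum // => /ltW Ln.
  set x := eigensum _ L in Lv Ln *; set y := eigensum f L in Lw Ln.
  (* three errors: v replaced by x, w replaced by y = f(A) x, S n x replaced by y *)
  have -> : u \dot w - u \dot S n v =
      (S n u \dot (x - v)) - (u \dot (y - w)) - (u \dot (S n x - y)).
    have sym a b : a \dot S n b = S n a \dot b.
      by rewrite /rdot simple_op_adj.
    rewrite !rdotBr -!sym; ring.
  have b1 : `|S n u \dot (x - v)| <= M * d.
    by rewrite (le_trans (cauchy_schwarz _ _ _)) // ler_pM.
  have b2 : `|u \dot (y - w)| <= N u * d.
    by rewrite (le_trans (cauchy_schwarz _ _ _)) // ler_pM.
  have b3 : `|u \dot (S n x - y)| <= N u * d.
    by rewrite (le_trans (cauchy_schwarz _ _ _)) // ler_pM.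
  rewrite (le_lt_trans (ler_normB _ _)) //.
  rewrite (le_lt_trans (lerD (ler_normB _ _) (lexx _))) //.
  rewrite (le_lt_trans (lerD (lerD b1 b2) b3)) //.
  have -> : e = 3 * (M + N u + 1) * d.
    by rewrite /d mulrC divfK // mulf_neq0 // gt_eqF // ltr_wpDl ?addr_ge0.
  by nra.
split=> //= u du; have [cr ci] := spectral_integral_cvg mf f0 du dv.
have diu : in_domain E f ('i%C *: u).
  by have := in_domain_i mf f0 1 du; rewrite expr1.
apply/eqP; rewrite eq_complex; apply/andP; split; apply/eqP.
  by rewrite -(cvg_lim _ cr) // -/(rdot dot u w) -(cvg_lim _ (key _ du)).
by rewrite -(cvg_lim _ ci) // Im_dot -(cvg_lim _ (key _ diu)).
Qed.

Lemma fun_calc_eigensum L : eigenlist L -> fun_calc E f (eigensum (fun=> 1) L, eigensum f L).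
Proof.
by move=> eL; apply: fun_calc_closure => e e0; exists L; rewrite !subrr hnorm0.
Qed.

(** <v, f(A) v> is real. *)
Lemma fun_calc_real v w : fun_calc E f (v, w) -> ('i%C *: v) \dot w = 0.
Proof.
move=> [dv /(_ _ dv) /= H]; rewrite -Im_dot H.
have [_ ci] := spectral_integral_cvg mf f0 dv dv.
rewrite -(cvg_lim _ ci) //.
under eq_fun => n.
  have -> : ('i%C *: v) \dot S n v = 0.
    rewrite -Im_dot; have := simple_op_adj E (sapprox mf n) v v.
    by rewrite (dotC dot v) conjcE; case: (dot _ _) => a b /= [] ?; lra.
  over.
by rewrite lim_cst.
Qed.

(** Symmetry of f(A), with one vector a sum of eigenvectors. *)
Lemma fun_calc_sym L v w : eigenlist L -> fun_calc E f (v, w) ->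
  eigensum (fun=> 1) L \dot w = eigensum f L \dot v.
Proof.
move=> eL [dv H].
have [dx _] := fun_calc_eigensum eL; set x := eigensum (fun=> 1) L in dx *.
have [cr _] := spectral_integral_cvg mf f0 dx dv.
have /= := H _ dx => /(congr1 (@complex.Re R)); rewrite -/(rdot dot x w) => ->.
rewrite -(cvg_lim _ cr) //; apply: cvg_lim => //.
have -> : (fun n => x \dot S n v) = (fun n => eigensum (sapprox mf n) L \dot v).
  by apply/funext => n; rewrite /rdot simple_op_adj simple_op_eigensum.
have c0 := @eigensum_cvg (fun n => sapprox mf n : R -> R) f L (sapprox_cvg mf f0).
apply/cvgrPdist_lt => e e0.
have d0 : 0 < e / (N v + 1) by rewrite divr_gt0 // ltr_wpDl.
move/cvgrPdist_lt : c0 => /(_ _ d0); apply: filterS => n /=.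
rewrite sub0r normrN ger0_norm // => Hn.
rewrite -rdotBl (le_lt_trans (cauchy_schwarz _ _ _)) // hnormBC.
have v1 : N v <= N v + 1 by rewrite lerDl.
rewrite (le_lt_trans (ler_wpM2l (hnorm_ge0 _ _) v1)) //.
by rewrite -ltr_pdivlMr // ltr_wpDl.
Qed.

End EigenLists.

(** * Eigenvectors lie in the range of a spectral projection *)

(** The integral over [D] only sees the subsets of [D]. *)
Lemma Rintegral_scale d (T : measurableType d) (R : realType)
    (m1 m2 : {measure set T -> \bar R}) (k : {nonneg R}) (D : set T) (h : T -> R) :
    measurable D -> (forall A, measurable A -> A `<=` D -> m1 A = k%:num%:E * m2 A)%E ->
    m2.-integrable D (EFin \o h) ->
  \int[m1]_(x in D) h x = k%:num * \int[m2]_(x in D) h x.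
Proof.
move=> mD m12 ih; rewrite /Rintegral.
rewrite (@eq_measure_integral _ _ _ _ (mscale k m2)) //.
have mh := measurable_int m2 ih.
rewrite integralE !ge0_integral_mscale //;
  try exact: measurable_funepos; try exact: measurable_funeneg.
have fp := integrable_pos_fin_num mD ih.
have fn := integrable_neg_fin_num mD ih.
rewrite [in RHS]integralE -(fineK fp) -(fineK fn) -!EFinM -!EFinB /=.
by rewrite mulrBr.
Qed.

Section Eigenvector.
Variables (R : realType) (K : lmodType R[i]) (dot : {dot K for @Num.conj R[i]}).
Variable E : spectral_measure (fun u v : K => dot v u).
Local Notation T := (measurableTypeR R).
Local Notation N := (hnorm dot).
Local Notation "u \dot v" := (rdot dot u v) (at level 40).
Variables (c : K) (l : R).
Local Notation mu := (pvm_mass E).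

(** Together with [pvm_mass_setD]: passing from c to E(B) c + a c multiplies the
    spectral mass by (1 + a)^2 on B and by a^2 off B. *)
Lemma pvm_mass_setI A B (a : R) : measurable A -> measurable B -> A `<=` B ->
  mu (pvm E B c + a%:C *: c) A = (((1 + a) ^+ 2)%:E * mu c A)%E.
Proof.
move=> mA mB AB; rewrite !pvm_massN // pvmD // pvmZ // pvm_inter //.
rewrite (setIidl AB) -{1}[pvm E A c]scale1r -scalerDl.
have -> : 1 + a%:C = (1 + a)%:C by rewrite rmorphD rmorph1.
by rewrite hnormZ -EFinM exprMn real_normK // num_real.
Qed.

Lemma pvm_mass_setD A B (a : R) : measurable A -> measurable B -> A `<=` ~` B ->
  mu (pvm E B c + a%:C *: c) A = ((a ^+ 2)%:E * mu c A)%E.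
Proof.
move=> mA mB AB; rewrite !pvm_massN // pvmD // pvmZ // pvm_inter //.
have -> : A `&` B = set0 by apply/disjoints_subset.
by rewrite pvm_set0 add0r hnormZ -EFinM exprMn real_normK // num_real.
Qed.

Lemma in_domain_pvm B (a : R) : measurable B -> in_domain E id c ->
  in_domain E id (pvm E B c + a%:C *: c).
Proof.
move=> mB dc.
have msq D : measurable_fun (D : set T) (fun x : T => (x ^+ 2)%:E).
  by apply/measurable_EFinP; apply: measurable_funX; exact: measurable_id.
have part D (k : {nonneg R}) : measurable D ->
    (forall A, measurable A -> A `<=` D ->
      mu (pvm E B c + a%:C *: c) A = (k%:num%:E * mu c A)%E) ->
    (\int[mu (pvm E B c + a%:C *: c)]_(x in D) (x ^+ 2)%:E < +oo)%E.
  move=> mD H; rewrite (@eq_measure_integral _ _ _ _ (mscale k (mu c))) //.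
  rewrite ge0_integral_mscale //; last by move=> x _; rewrite lee_fin sqr_ge0.
  apply: lte_mul_pinfty => //.
  apply: le_lt_trans dc; apply: ge0_subset_integral => //.
  by move=> x _; rewrite lee_fin sqr_ge0.
rewrite /in_domain -(setUv B) ge0_integral_setU //.
- apply: lte_add_pinfty.
    apply: (part B (NngNum (sqr_ge0 (1 + a)))) => // A mA AB.
    exact: pvm_mass_setI.
  apply: (part (~` B) (NngNum (sqr_ge0 a))); first exact: measurableC.
  by move=> A mA AB; exact: pvm_mass_setD.
- exact: measurableC.
- by move=> x _; rewrite lee_fin sqr_ge0.
- by apply/disj_setPS; rewrite setICr.
Qed.

Lemma in_domain_integrable w D : measurable D -> in_domain E id w ->
  (mu w).-integrable D (EFin \o (id : T -> R)).
Proof.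
move=> mD dw; apply: (@integrableS _ _ _ _ setT) => //.
apply/integrableP; split; first by apply/measurable_EFinP; exact: measurable_id.
apply: (@le_lt_trans _ _ (\int[mu w]_x (1 + x ^+ 2)%:E)%E).
  apply: ge0_le_integral => //.
  - apply: measurableT_comp => //; apply/measurable_EFinP; exact: measurable_id.
  - apply/measurable_EFinP; apply: measurable_funD => //.
  - move=> x _; rewrite /= lee_fin; have := sqr_ge0 (`|x| - 1).
    have := normr_ge0 x; rewrite sqrrB1 real_normK ?num_real //; lra.
under eq_integral do rewrite EFinD.
rewrite ge0_integralD //.
- by rewrite lte_add_pinfty // integral_cst // mul1e pvm_mass_fin.
- by move=> x _; rewrite lee_fin sqr_ge0.
- by apply/measurable_EFinP; apply: measurable_funX; exact: measurable_id.
Qed.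

Hypothesis cl : fun_calc E id (c, l%:C *: c).

(** The equation A c = l c is tested against u = E(B) c. The real part of the
    polarization formula only involves the masses of u + c and u - c. They agree off B,
    where they cancel, and are 4 times the mass of c and 0 on B. *)
Lemma eigen_Rintegral B : measurable B ->
  l * fine (mu c B) = \int[mu c]_(x in B) x.
Proof.
move=> mB; have [dc H] := cl.
have dp a : in_domain E id (pvm E B c + a%:C *: c) by exact: in_domain_pvm.
have := H (pvm E B c).
have d0 : in_domain E id (pvm E B c).
  by have := dp 0; rewrite scale0r addr0.
move=> /(_ d0) /(congr1 (@complex.Re R)) /=; rewrite -/(rdot dot _ _).
rewrite /spectral_integral
  (polar_sum (fun k => \int[mu (pvm E B c + 'i%C ^+ k *: c)]_x x)) /=.
rewrite sqr_i expr0.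
have split a (k : {nonneg R}) : k%:num = (1 + a) ^+ 2 -> a ^+ 2 = 1 ->
    \int[mu (pvm E B c + a%:C *: c)]_x x =
    k%:num * \int[mu c]_(x in B) x + \int[mu c]_(x in ~` B) x.
  move=> ka a1; rewrite -(setUv B) Rintegral_setU //.
  - congr (_ + _).
      rewrite (@Rintegral_scale _ _ _ _ (mu c) k) //.
      + by move=> A mA AB; rewrite ka; exact: pvm_mass_setI.
      + exact: in_domain_integrable.
    rewrite (@Rintegral_scale _ _ _ _ (mu c) (NngNum (sqr_ge0 a))) /=.
    + by rewrite a1 mul1r.
    + exact: measurableC.
    + by move=> A mA AB; exact: pvm_mass_setD.
    + by apply: in_domain_integrable => //; exact: measurableC.
  - exact: measurableC.
  - by rewrite setUv; exact: in_domain_integrable.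
  - by apply/disj_setPS; rewrite setICr.
have -> : (1 : R[i]) = (1 : R)%:C by [].
have -> : (-1 : R[i]) = (-1 : R)%:C by rewrite rmorphN rmorph1.
rewrite (split 1 (NngNum (sqr_ge0 (1 + 1)))) ?expr1n //.
rewrite (split (-1) (NngNum (sqr_ge0 (1 - 1)))) ?sqrrN ?expr1n //=.
rewrite rdotZr pvm_massE //= => H1.
have -> : complex.Re (dot (pvm E B c) c) = rdot dot (pvm E B c) c.
  by rewrite rdotC.
rewrite H1; lra.
Qed.

Lemma measurable_ray (s e : R) : measurable [set x : T | e <= s * (x - l)].
Proof.
rewrite -[X in measurable X]setTI; apply: measurable_fun_le => //.
by apply: measurable_funM => //; apply: measurable_funB => //; exact: measurable_id.
Qed.

(** On this half-line, x lies on one side of l at distance at least 1/(m+1), so that a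
    positive mass would contradict [eigen_Rintegral]. *)
Lemma eigen_mass_ray (s : R) (m : nat) : s ^+ 2 = 1 ->
  mu c [set x : T | m.+1%:R^-1 <= s * (x - l)] = 0%E.
Proof.
move=> s1; set B := [set x | _].
have mB : measurable B by exact: measurable_ray.
have [dc _] := cl.
have iB := in_domain_integrable mB dc.
have e0 : 0 < m.+1%:R^-1 :> R by rewrite invr_gt0.
have finB : (mu c B \is a fin_num)%E by rewrite ge0_fin_numE // pvm_mass_fin.
have : \int[mu c]_(x in B) (m.+1%:R^-1 + s * l) <= \int[mu c]_(x in B) (s * x).
  apply: le_Rintegral => //.
  - apply/integrableP; split; first exact/measurable_EFinP.
    by rewrite /= integral_cst // lte_mul_pinfty ?lee_fin ?pvm_mass_fin.
  - exact: (integrableZl mB s iB).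
  - by move=> x; rewrite /B /= mulrBr lerBrDr.
rewrite Rintegral_cst // RintegralZl // -eigen_Rintegral // => H.
have H0 : 0 <= fine (mu c B) by exact: fine_ge0.
move: H; rewrite mulrDl mulrA gerDr pmulr_rle0 // => H.
have H1 : fine (mu c B) = 0 by apply/eqP; rewrite eq_le H H0.
by rewrite -(fineK finB) H1.
Qed.

(** All of the spectral mass of [c] sits at [l]. *)
Lemma eigenvector : pvm E [set l] c = c.
Proof.
have ml : measurable ([set l] : set T) by [].
suff H : mu c (~` [set l]) = 0%E.
  have : mu c [set: T] = mu c ([set l] : set T).
    rewrite -(setUv ([set l] : set T)) measureU ?setICr //; last exact: measurableC.
    by rewrite [X in (_ + X)%E]H adde0.
  rewrite pvm_massT pvm_massN // => -[] H1.
  apply/eqP; rewrite -subr_eq0; apply/eqP; apply: (@rdot_eq0 _ _ dot).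
  have P1 : rdot dot c (pvm E [set l] c) = hnorm dot (pvm E [set l] c) ^+ 2.
    by rewrite hnorm_sqr /rdot pvm_dot // setIid.
  rewrite rdotBl !rdotBr (rdotC _ _ c) P1 -!hnorm_sqr; lra.
apply/eqP; rewrite eq_le measure_ge0 andbT.
have sub : (~` [set l] : set T) `<=` \bigcup_m
   ([set x : T | m.+1%:R^-1 <= 1 * (x - l)] `|` [set x : T | m.+1%:R^-1 <= -1 * (x - l)]).
  move=> x /= xl.
  have d0 : 0 < `|x - l| by rewrite normr_gt0 subr_eq0; apply/eqP.
  exists (Num.truncn `|x - l|^-1) => //.
  have : (Num.truncn `|x - l|^-1).+1%:R^-1 <= `|x - l|.
    by rewrite invf_ple ?posrE ?ltr0Sn // ltW // truncnS_gt.
  rewrite /= mul1r mulN1r; case: (ger0P (x - l)) => _; [by left|by right].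
suff : (mu c).-negligible (~` [set l] : set T).
  by move=> /negligibleP -> //; exact: measurableC.
apply: (negligibleS sub); apply: negligible_bigcup => m; apply: negligibleU.
  apply/negligibleP; [exact: measurable_ray|exact: eigen_mass_ray (expr1n _ _)].
by apply/negligibleP; [exact: measurable_ray|apply: eigen_mass_ray; rewrite sqrrN expr1n].
Qed.

End Eigenvector.

(** * The q-number of a self-adjoint operator *)

Lemma qdiff_neq0 (R : realType) (q : R) : 0 < q < 1 -> q - q^-1 != 0.
Proof.
case/andP=> q0 q1; rewrite subr_eq0 lt_eqF //.
by rewrite (lt_trans q1) // invf_gt1.
Qed.

Section QNumberOperator.
Variables (R : realType) (K : lmodType R[i]) (dot : {dot K for @Num.conj R[i]}).
Variable E : spectral_measure (fun u v : K => dot v u).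
Local Notation T := (measurableTypeR R).
Local Notation N := (hnorm dot).
Local Notation "u \dot v" := (rdot dot u v) (at level 40).
Implicit Types (u v w : K) (L : seq (R * K)).

(** Eigenvectors for distinct eigenvalues are orthogonal. *)
Lemma rdot_eigensum (a b a' b' : R -> R) L L' : eigenlist E L -> eigenlist E L' ->
    (forall l, a l * b l = a' l * b' l) ->
  eigensum a L \dot eigensum b L' = eigensum a' L \dot eigensum b' L'.
Proof.
move=> eL eL' ab; rewrite /rdot /eigensum !linear_sumlz !Re_sum.
apply: eq_big_seq => p pL'; rewrite !linear_sumr !Re_sum.
apply: eq_big_seq => r rL /=.
rewrite !linearZl_LR !linearZr_LR /= !conjcE !conjc_real !ReZ.
have [->|pr] := eqVneq p.1 r.1.
  by rewrite !mulrA ab.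
rewrite -(eL' _ pL') -(eL _ rL) pvm_disjoint ?mulr0 //.
by apply/seteqP; split => // y [/= -> E1]; rewrite E1 eqxx in pr.
Qed.

Variables (q : R) (hq : 0 < q < 1).
Let q0 : 0 < q. Proof. by case/andP: hq. Qed.
Local Notation qp := (fun x : R => q `^ x).
Local Notation qm := (fun x : R => q `^ (- x)).
Local Notation lam := (q - q^-1).

Lemma measurable_qp : measurable_fun [set: T] (qp : T -> R).
Proof.
rewrite (_ : qp = (fun x => expR (x * ln q))); last first.
  by apply/funext => x; rewrite /powR gt_eqF.
apply: (@measurableT_comp _ _ _ _ _ _ (@expR R)) => //.
by apply: measurable_funM => //; exact: measurable_id.
Qed.

Lemma measurable_qm : measurable_fun [set: T] (qm : T -> R).
Proof.
rewrite (_ : qm = (fun x => expR (- x * ln q))); last first.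
  by apply/funext => x; rewrite /powR gt_eqF.
apply: (@measurableT_comp _ _ _ _ _ _ (@expR R)) => //.
apply: measurable_funM => //; exact: measurableT_comp.
Qed.

Let qp0 x : 0 <= qp x. Proof. exact: powR_ge0. Qed.
Let qm0 x : 0 <= qm x. Proof. exact: powR_ge0. Qed.

Lemma eigensum_qnum L :
  eigensum (qnum q) L = (lam^-1)%:C *: (eigensum qp L - eigensum qm L).
Proof.
rewrite /eigensum -sumrB scaler_sumr; apply: eq_bigr => p _.
by rewrite -scalerBl -rmorphB scalerA -rmorphM mulrC.
Qed.

(** In |q^A x - q^(-A) x|^2 the cross term is 2 |x|^2, as q^A q^(-A) = 1. Hence the
    graph norm of [A] controls those of q^A and q^(-A). *)
Lemma hnorm_eigensum_qnum L : eigenlist E L ->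
  N (eigensum qp L) ^+ 2 + N (eigensum qm L) ^+ 2 =
  (lam * N (eigensum (qnum q) L)) ^+ 2 + 2 * N (eigensum (fun=> 1) L) ^+ 2.
Proof.
move=> eL; rewrite exprMn eigensum_qnum !hnorm_sqr rdotZl rdotZr.
have H : eigensum qp L \dot eigensum qm L = eigensum (fun=> 1) L \dot eigensum (fun=> 1) L.
  apply: rdot_eigensum => // l; rewrite mulr1 -powRD; last by rewrite (gt_eqF q0); apply/implyP.
  by rewrite subrr powRr0.
rewrite -H !rdotBl !rdotBr (rdotC _ (eigensum qm L)).
have := qdiff_neq0 hq; move: lam => c c0; by field.
Qed.

Lemma hnorm_eigensum_le L : eigenlist E L ->
  N (eigensum qp L) <= `|lam| * N (eigensum (qnum q) L) + 2 * N (eigensum (fun=> 1) L) /\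
  N (eigensum qm L) <= `|lam| * N (eigensum (qnum q) L) + 2 * N (eigensum (fun=> 1) L).
Proof.
move=> /hnorm_eigensum_qnum.
rewrite exprMn -[lam ^+ 2]real_normK ?num_real // -exprMn.
set a := N _; set b := N _; set c := N (eigensum (qnum q) L); set d := N _.
have [a0 b0 d0] : [/\ 0 <= a, 0 <= b & 0 <= d] by split; exact: hnorm_ge0.
have : 0 <= `|lam| * c by rewrite mulr_ge0 // hnorm_ge0.
move: (_ * c) => z z0 H.
have zd : 0 <= z + 2 * d by lra.
split; rewrite -(@ler_pXn2r _ 2) ?nnegrE //.
  have := sqr_ge0 b; have := mulr_ge0 z0 d0; have := sqr_ge0 d; rewrite sqrrD; nra.
have := sqr_ge0 a; have := mulr_ge0 z0 d0; have := sqr_ge0 d; rewrite sqrrD; nra.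
Qed.

Hypothesis complete : forall x : nat -> K,
  (forall e, 0 < e -> exists n0, forall m n, (n0 <= m)%N -> (n0 <= n)%N ->
     N (x m - x n) < e) ->
  exists y, forall e, 0 < e -> exists n0, forall n, (n0 <= n)%N -> N (x n - y) < e.

(** [G] is the graph of [A] on some sums of eigenvectors, and [A] + i has dense range
    on them. *)
Variable G : set (K * K).
Hypothesis G_diag : forall p, G p ->
  exists2 L, eigenlist E L & p = (eigensum (fun=> 1) L, eigensum (qnum q) L).
Hypothesis G_dense : forall v e, 0 < e ->
  exists2 p, G p & N (v - (p.2 + 'i%C *: p.1)) < e.

(** A convergent sequence in [G] is Cauchy for the graph norm of [A], hence for those
    of q^A and q^(-A) by [hnorm_eigensum_le]; completeness gives the two limits and
    [fun_calc_closure] puts them into the graphs. *)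
Lemma closure_sub_qnum v w :
    (forall e, 0 < e -> exists p, [/\ G p, N (p.1 - v) < e & N (p.2 - w) < e]) ->
  exists w1 w2, [/\ fun_calc E qp (v, w1), fun_calc E qm (v, w2) &
    w = (lam^-1)%:C *: (w1 - w2)].
Proof.
move=> H.
have /choice [L HL] : forall n : nat, exists L, [/\ eigenlist E L,
    N (eigensum (fun=> 1) L - v) < n.+1%:R^-1 & N (eigensum (qnum q) L - w) < n.+1%:R^-1].
  move=> n; have [|p [Gp]] := H (n.+1%:R^-1); first by rewrite invr_gt0.
  by have [L eL ->] := G_diag Gp; exists L.
have small (e : R) : 0 < e -> exists n0, forall n, (n0 <= n)%N -> n.+1%:R^-1 < e.
  move=> e0; exists (Num.truncn e^-1) => n n0n.
  rewrite invf_plt ?posrE // (lt_le_trans (truncnS_gt _)) // ler_nat ltnS //.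
pose x n := eigensum (fun=> 1) (L n); pose y n := eigensum (qnum q) (L n).
have cv (e : R) : 0 < e -> exists n0, forall n, (n0 <= n)%N ->
    N (x n - v) < e /\ N (y n - w) < e.
  move=> /small [n0 Hn]; exists n0 => n /Hn ne; have [_ Lv Lw] := HL n.
  by split; exact: lt_trans ne.
have cauchy f : (forall L, eigenlist E L ->
      N (eigensum f L) <= `|lam| * N (eigensum (qnum q) L) + 2 * N (eigensum (fun=> 1) L)) ->
    exists z, forall e, 0 < e -> exists n0, forall n, (n0 <= n)%N ->
      N (eigensum f (L n) - z) < e.
  move=> Hf; apply: complete => e e0.
  have d0 : 0 < e / (2 * (`|lam| + 2)) by rewrite divr_gt0 // mulr_gt0 // ltr_wpDl.
  set d := e / _ in d0; have [n0 Hn] := cv _ d0.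
  exists n0 => m n /Hn [xm ym] /Hn [xn yn].
  (* the difference of two eigenvector sums is again one *)
  have bB g : eigensum g (L m ++ [seq (p.1, -1 *: p.2) | p <- L n]) =
      eigensum g (L m) - eigensum g (L n).
    by rewrite eigensum_cat eigensum_map scaleN1r.
  rewrite -bB (le_lt_trans (Hf _ _)) //.
    apply: eigenlist_cat; last apply: eigenlist_map; by have [] := HL m; have [] := HL n.
  rewrite !bB -/(x m) -/(x n) -/(y m) -/(y n).
  have b1 : N (x m - x n) < 2 * d.
    by rewrite (le_lt_trans (hnorm_dist _ _ v _)) // (hnormBC _ v); lra.
  have b2 : N (y m - y n) <= 2 * d.
    by rewrite ltW // (le_lt_trans (hnorm_dist _ _ w _)) // (hnormBC _ w); lra.
  have -> : e = `|lam| * (2 * d) + 2 * (2 * d).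
    have : `|lam| + 2 != 0 by rewrite gt_eqF // ltr_wpDl.
    by rewrite /d; move: `|lam| => z z0; field.
  by rewrite ler_ltD // ?ler_wpM2l // ltr_pM2l.
have [w1 Hw1] := cauchy qp (fun L eL => (hnorm_eigensum_le eL).1).
have [w2 Hw2] := cauchy qm (fun L eL => (hnorm_eigensum_le eL).2).
have fc f z : measurable_fun [set: T] (f : T -> R) -> (forall l, 0 <= f l) ->
    (forall e, 0 < e -> exists n0, forall n, (n0 <= n)%N ->
      N (eigensum f (L n) - z) < e) -> fun_calc E f (v, z).
  move=> mf f0 Hf; apply: (fun_calc_closure mf f0) => e e0.
  have [n1 H1] := cv _ e0; have [n2 H2] := Hf _ e0.
  exists (L (maxn n1 n2)); have [eL _ _] := HL (maxn n1 n2).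
  by split => //; [have [] := H1 _ (leq_maxl n1 n2)|exact: H2 (leq_maxr _ _)].
exists w1, w2; split; first exact: fc measurable_qp _ Hw1.
  exact: fc measurable_qm _ Hw2.
apply/eqP; rewrite -subr_eq0; apply/eqP/(@rdot_eq0 _ _ dot); rewrite -hnorm_sqr.
apply/eqP; rewrite sqrf_eq0 eq_le hnorm_ge0 andbT; apply/ler_addgt0Pr => e e0.
rewrite add0r.
have l0 : 0 < `|lam^-1| by rewrite normr_gt0 invr_eq0 (qdiff_neq0 hq).
have d0 : 0 < e / (1 + 2 * `|lam^-1|) by rewrite divr_gt0 // addr_gt0 // mulr_gt0.
set d := e / _ in d0.
have [n0 H0] := cv _ d0; have [n1 H1] := Hw1 _ d0; have [n2 H2] := Hw2 _ d0.
pose n := maxn n0 (maxn n1 n2).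
have [_ yw] := H0 n (leq_maxl _ _).
have P1 := H1 n (leq_trans (leq_maxl _ _) (leq_maxr _ _)).
have P2 := H2 n (leq_trans (leq_maxr _ _) (leq_maxr _ _)).
have -> : w - lam^-1%:C *: (w1 - w2) = - (y n - w) +
    lam^-1%:C *: ((eigensum qp (L n) - w1) - (eigensum qm (L n) - w2)).
  have -> : eigensum qp (L n) - w1 - (eigensum qm (L n) - w2) =
      (eigensum qp (L n) - eigensum qm (L n)) - (w1 - w2) by rewrite !opprD !opprK addrACA.
  by rewrite [X in _ = _ + X]scalerBr -eigensum_qnum -/(y n) opprB addrA subrK.
rewrite (le_trans (hnormD _ _ _)) // hnormN hnormZ.
have P3 : N (eigensum qp (L n) - w1 - (eigensum qm (L n) - w2)) <= 2 * d.
  by rewrite (le_trans (hnormD _ _ _)) // hnormN; lra.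
have -> : e = d + `|lam^-1| * (2 * d).
  have : 1 + 2 * `|lam^-1| != 0 by rewrite gt_eqF // addr_gt0 // mulr_gt0.
  by rewrite /d; move: `|lam^-1| => z z0; field.
by rewrite lerD ?ler_wpM2l // ltW.
Qed.

(** The argument for essential self-adjointness. Choose p in [G] with p.2 + i p.1 close
    to w + i v. With a = w - p.2 and b = v - p.1, symmetry makes a and i b orthogonal
    for the real inner product, so |a|^2 + |b|^2 = |a + i b|^2 is small. *)
Lemma qnum_sub_closure v w1 w2 (w := (lam^-1)%:C *: (w1 - w2)) :
    fun_calc E qp (v, w1) -> fun_calc E qm (v, w2) ->
  forall e, 0 < e -> exists p, [/\ G p, N (p.1 - v) < e & N (p.2 - w) < e].
Proof.
move=> H1 H2 e e0.
have real x z1 z2 : fun_calc E qp (x, z1) -> fun_calc E qm (x, z2) ->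
    ('i%C *: x) \dot ((lam^-1)%:C *: (z1 - z2)) = 0.
  move=> /(fun_calc_real measurable_qp qp0) h1 /(fun_calc_real measurable_qm qm0) h2.
  by rewrite rdotZr rdotBr h1 h2 subrr mulr0.
have sym L : eigenlist E L -> eigensum (fun=> 1) L \dot w = eigensum (qnum q) L \dot v.
  move=> eL; rewrite eigensum_qnum rdotZr rdotZl rdotBr rdotBl.
  rewrite (fun_calc_sym measurable_qp qp0 eL H1).
  by rewrite (fun_calc_sym measurable_qm qm0 eL H2).
have [p Gp ne] := G_dense (w + 'i%C *: v) e0.
exists p; have [L eL pE] := G_diag Gp.
have c1 : ('i%C *: v) \dot w = 0 by exact: real.
have c2 : ('i%C *: p.1) \dot p.2 = 0.
  rewrite pE /= eigensum_qnum; apply: real; apply: fun_calc_eigensum => //.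
    exact: measurable_qp.
  exact: measurable_qm.
have c3 : ('i%C *: p.1) \dot w = ('i%C *: p.2) \dot v.
  by rewrite pE /= -!eigensum_map; apply: sym; exact: eigenlist_map.
have c4 : ('i%C *: p.2) \dot v = - (p.2 \dot ('i%C *: v)).
  rewrite /rdot linearZl_LR linearZr_LR /= conjcE.
  by case: (dot v p.2) => a b /=; ring.
set a := w - p.2; set b := v - p.1.
have {}ne : N (a + 'i%C *: b) < e.
  by move: ne; rewrite /a /b scalerBr opprD addrACA.
have ab : a \dot ('i%C *: b) = 0.
  rewrite /a /b scalerBr !rdotBr !rdotBl (rdotC _ w) c1 (rdotC _ w) c3 c4.
  rewrite (rdotC _ p.2 ('i%C *: p.1)) c2; ring.
have pyth x y : x \dot y = 0 -> N (x + y) ^+ 2 = N x ^+ 2 + N y ^+ 2.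
  by move=> xy; rewrite !hnorm_sqr rdotDl !rdotDr (rdotC dot y x) xy addr0 add0r.
have ne2 : N a ^+ 2 + N b ^+ 2 < e ^+ 2.
  by rewrite -(hnormi dot b) -pyth // ltr_pXn2r // nnegrE // ltW.
have := sqr_ge0 (N a); have := sqr_ge0 (N b) => b2 a2.
split => //; rewrite hnormBC -(@ltr_pXn2r _ 2) ?nnegrE ?(ltW e0) //.
  by rewrite -/b; lra.
by rewrite -/a; lra.
Qed.

End QNumberOperator.

(** * The Hilbert space of spinors *)

Section PairDot.
Variables (R : realType) (H : completeNormedModType R[i])
  (dot : {dot H for @Num.conj R[i]}).

(** [spinor_ip] with its arguments exchanged, to be linear in the first one. *)
Definition pair_dot (v u : H * H) : R[i] := spinor_ip dot u v.

Lemma pair_dot_bilinear : bilinear_for (GRing.Scale.Law.clone _ _ ( *%R ) _)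
  (GRing.Scale.Law.clone _ _ (@Num.conj R[i] \; *%R) _) pair_dot.
Proof.
split=> [u'|u] a x y; rewrite /pair_dot /spinor_ip /=.
  by rewrite !linearPl /= mulrDr addrACA.
by rewrite !linearPr /= mulrDr addrACA.
Qed.

HB.instance Definition _ := bilinear_isBilinear.Build R[i] (H * H)%type (H * H)%type R[i]
  _ _ pair_dot pair_dot_bilinear.

Lemma pair_dot_herm x y : pair_dot x y = (-1) ^+ false * Num.conj (pair_dot y x).
Proof.
by rewrite expr0 mul1r /pair_dot /spinor_ip rmorphD; congr (_ + _); exact: dotC.
Qed.

HB.instance Definition _ := isHermitianSesquilinear.Build R[i] (H * H)%type false
  (@Num.conj R[i]) pair_dot pair_dot_herm.

Lemma pair_dot_gt0 u : u != 0 -> 0 < pair_dot u u.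
Proof.
move=> u0; rewrite /pair_dot /spinor_ip.
have [u1|u1] := eqVneq u.1 0; last first.
  by apply: ltr_wpDr; [exact: dnorm_ge0|rewrite dnorm_gt0].
rewrite u1 linear0l add0r dnorm_gt0.
by apply: contraNneq u0 => u2; apply/eqP; case: u u1 u2 => a b /= -> ->.
Qed.

HB.instance Definition _ := isDotProduct.Build R[i] (H * H)%type pair_dot pair_dot_gt0.

Definition pdot : {dot (H * H)%type for @Num.conj R[i]} := pair_dot.

End PairDot.

Section PairTopology.
Variables (R : realType) (H : completeNormedModType R[i])
  (dot : {dot H for @Num.conj R[i]}).
Hypothesis dot_norm : forall v : H, `|v| ^+ 2 = dot v v.
Local Notation N1 := (hnorm dot).
Local Notation N := (hnorm (pdot dot)).

Lemma norm_hnorm (v : H) : `|v| = (N1 v)%:C.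
Proof.
have h0 : 0 <= (N1 v)%:C :> R[i] by rewrite ler0c.
apply/eqP; rewrite -(@eqrXn2 _ 2) // -rmorphXn /= hnorm_sqr dot_norm.
rewrite /rdot [X in X == _]complexE (ger0_Im (dnorm_ge0 dot v)) mulr0 addr0.
exact: eqxx.
Qed.

Lemma hnorm_pair (p : H * H) : N p ^+ 2 = N1 p.1 ^+ 2 + N1 p.2 ^+ 2.
Proof. by rewrite !hnorm_sqr /rdot /= /pair_dot /spinor_ip ReD. Qed.

Lemma hnorm_pair_le (p : H * H) : N p <= N1 p.1 + N1 p.2.
Proof.
rewrite -(@ler_pXn2r _ 2) ?nnegrE ?addr_ge0 // hnorm_pair sqrrD.
by rewrite -addrA [_ *+ 2 + _]addrC addrA lerDl mulrn_wge0 // mulr_ge0.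
Qed.

Lemma hnorm_fst (p : H * H) : N1 p.1 <= N p.
Proof.
by rewrite -(@ler_pXn2r _ 2) ?nnegrE // hnorm_pair lerDl sqr_ge0.
Qed.

Lemma hnorm_snd (p : H * H) : N1 p.2 <= N p.
Proof.
by rewrite -(@ler_pXn2r _ 2) ?nnegrE // hnorm_pair lerDr sqr_ge0.
Qed.

Lemma ball_hnorm (x y : H) (e : R) : ball x e%:C y <-> N1 (x - y) < e.
Proof. by rewrite -ball_normE /= norm_hnorm ltcR. Qed.

Lemma posC (e : R[i]) : 0 < e -> exists2 r : R, 0 < r & e = r%:C.
Proof.
case: e => a b; rewrite ltcE /= => /andP[/eqP -> a0].
by exists a.
Qed.

(** The Hilbert norm induces the product topology on each of the two factors. *)
Lemma pair_closureP (S : set ((H * H) * (H * H))) p :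
  closure S p <->
  (forall e, 0 < e -> exists p', [/\ S p', N (p'.1 - p.1) < e & N (p'.2 - p.2) < e]).
Proof.
split=> [cS e e0|HS B].
  have e2 : 0 < (e / 2)%:C :> R[i] by rewrite ltcR divr_gt0.
  have [p' [Sp' [[B1 B2] [B3 B4]]]] := cS _ (nbhsx_ballx p _ e2).
  exists p'; split => //; rewrite hnormBC (le_lt_trans (hnorm_pair_le _)) //.
    by move/ball_hnorm: B1 => /=; move/ball_hnorm: B2 => /=; lra.
  by move/ball_hnorm: B3 => /=; move/ball_hnorm: B4 => /=; lra.
move=> /nbhs_ballP [d /= /posC [r r0 ->]] sB.
have [p' [Sp' P1 P2]] := HS _ r0.
exists p'; split => //; apply: sB; split; split; apply/ball_hnorm; rewrite hnormBC.
- exact: le_lt_trans (hnorm_fst (p'.1 - p.1)) P1.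
- exact: le_lt_trans (hnorm_snd (p'.1 - p.1)) P1.
- exact: le_lt_trans (hnorm_fst (p'.2 - p.2)) P2.
- exact: le_lt_trans (hnorm_snd (p'.2 - p.2)) P2.
Qed.

Lemma hnorm_complete_factor (x : nat -> H) :
    (forall e, 0 < e -> exists n0, forall m n, (n0 <= m)%N -> (n0 <= n)%N ->
      N1 (x m - x n) < e) ->
  exists y, forall e, 0 < e -> exists n0, forall n, (n0 <= n)%N -> N1 (x n - y) < e.
Proof.
move=> cx.
have /cauchy_cvg/cvg_ex[y xy] : cauchy (x @ \oo).
  apply/cauchy_exP => e /posC [r r0 ->]; have [n0 Hn] := cx _ r0.
  exists (x n0); exists n0 => // n /= n0n; apply/ball_hnorm; exact: Hn.
exists y => e e0.
have e0C : 0 < e%:C :> R[i] by rewrite ltcR.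
move/cvg_ballP : xy => /(_ _ e0C) [n0 _ Hn].
by exists n0 => n n0n; rewrite hnormBC; apply/ball_hnorm; exact: Hn.
Qed.

Lemma hnorm_complete (x : nat -> H * H) :
    (forall e, 0 < e -> exists n0, forall m n, (n0 <= m)%N -> (n0 <= n)%N ->
      N (x m - x n) < e) ->
  exists y, forall e, 0 < e -> exists n0, forall n, (n0 <= n)%N -> N (x n - y) < e.
Proof.
move=> cx.
have [|y1 H1] := @hnorm_complete_factor (fun n => (x n).1).
  move=> e /cx [n0 Hn]; exists n0 => m n mn nn.
  exact: le_lt_trans (hnorm_fst (x m - x n)) (Hn _ _ mn nn).
have [|y2 H2] := @hnorm_complete_factor (fun n => (x n).2).
  move=> e /cx [n0 Hn]; exists n0 => m n mn nn.
  exact: le_lt_trans (hnorm_snd (x m - x n)) (Hn _ _ mn nn).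
exists (y1, y2) => e e0; have e2 : 0 < e / 2 by rewrite divr_gt0.
have [n1 Hn1] := H1 _ e2; have [n2 Hn2] := H2 _ e2.
exists (maxn n1 n2) => n; rewrite geq_max => /andP[/Hn1 P1 /Hn2 P2].
by rewrite (le_lt_trans (hnorm_pair_le _)) //=; lra.
Qed.

End PairTopology.

(** * Matrices on a tensor product *)

Section Matrices.
Local Open Scope sesquilinear_scope.
Variable (C : numClosedFieldType).

Lemma adjmxM m n p (A : 'M[C]_(m, n)) (B : 'M[C]_(n, p)) : (A *m B)^t* = B^t* *m A^t*.
Proof. by rewrite trmx_mul map_mxM. Qed.

Lemma adjmxD m n (A B : 'M[C]_(m, n)) : (A + B)^t* = A^t* + B^t*.
Proof. by apply/matrixP => i j; rewrite !mxE rmorphD. Qed.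

Lemma adjmxZ m n c (A : 'M[C]_(m, n)) : (c *: A)^t* = Num.conj c *: A^t*.
Proof. by apply/matrixP => i j; rewrite !mxE rmorphM. Qed.

Lemma adjmx_tens m n p r (A : 'M[C]_(m, n)) (B : 'M[C]_(p, r)) :
  (A *t B)^t* = (A^t*) *t (B^t*).
Proof. by apply/matrixP => i j; rewrite !mxE rmorphM. Qed.

Lemma adjmx_sum m n (I : Type) (s : seq I) (P : pred I) (A : I -> 'M[C]_(m, n)) :
  (\sum_(i <- s | P i) A i)^t* = \sum_(i <- s | P i) (A i)^t*.
Proof.
by apply/matrixP => i j; rewrite !mxE !summxE rmorph_sum; apply: eq_bigr => k _; rewrite !mxE.
Qed.

Lemma hermsymmxP n (A : 'M[C]_n) : A^t* = A -> A \is hermsymmx.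
Proof. by move=> H; apply/is_hermitianmxP; rewrite expr0 scale1r. Qed.

(** The operator-valued matrix entries with respect to the second tensor factor. *)
Definition blk d e (a b : 'I_e) (M : 'M[C]_(d * e)) : 'M[C]_d :=
  \matrix_(i, j) M (mxtens_index (i, a)) (mxtens_index (j, b)).

Lemma sum_mxtens d e (F : 'I_(d * e) -> C) :
  \sum_k F k = \sum_(b < e) \sum_(j < d) F (mxtens_index (j, b)).
Proof.
rewrite (reindex (@mxtens_index d e)) /=; last first.
  by apply: onW_bij; exact: (Bijective (@mxtens_indexK d e) (@mxtens_unindexK d e)).
rewrite exchange_big /= pair_big /=; apply: eq_bigr => -[i j] _ //.
Qed.

Lemma blkP d e (M N : 'M[C]_(d * e)) : (forall a b, blk a b M = blk a b N) -> M = N.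
Proof.
move=> H; apply/matrixP => x y; case: (mxtens_indexP x) => i a; case: (mxtens_indexP y) => j b.
by have /matrixP/(_ i j) := H a b; rewrite !mxE.
Qed.

Lemma blkM d e (a b : 'I_e) (M N : 'M[C]_(d * e)) :
  blk a b (M *m N) = \sum_c blk a c M *m blk c b N.
Proof.
apply/matrixP => i j; rewrite !mxE sum_mxtens summxE; apply: eq_bigr => c _.
by rewrite !mxE; apply: eq_bigr => k _; rewrite !mxE.
Qed.

Lemma blk_adj d e (a b : 'I_e) (M : 'M[C]_(d * e)) : blk a b (M^t*) = (blk b a M)^t*.
Proof. by apply/matrixP => i j; rewrite !mxE. Qed.

Lemma blkD d e (a b : 'I_e) (M N : 'M[C]_(d * e)) : blk a b (M + N) = blk a b M + blk a b N.
Proof. by apply/matrixP => i j; rewrite !mxE. Qed.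

Lemma blkN d e (a b : 'I_e) (M : 'M[C]_(d * e)) : blk a b (- M) = - blk a b M.
Proof. by apply/matrixP => i j; rewrite !mxE. Qed.

Lemma blkZ d e (a b : 'I_e) c (M : 'M[C]_(d * e)) : blk a b (c *: M) = c *: blk a b M.
Proof. by apply/matrixP => i j; rewrite !mxE. Qed.

Lemma blk_tens d e (a b : 'I_e) (A : 'M[C]_d) (B : 'M[C]_e) : blk a b (A *t B) = B a b *: A.
Proof. by apply/matrixP => i j; rewrite !mxE !mxtens_indexK mulrC. Qed.

Lemma blk1 d e (a b : 'I_e) : blk a b (1%:M : 'M[C]_(d * e)) = (a == b)%:R *: 1%:M.
Proof.
apply/matrixP => i j; rewrite !mxE (can_eq (@mxtens_indexK d e)) xpair_eqE.
by rewrite andbC -natrM mulnb.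
Qed.

End Matrices.

Section FunMx.
Variable R : realType.

(** Independence of the functional calculus from the diagonalization: the matrix which
    intertwines two diagonal matrices only connects equal eigenvalues. *)
Lemma fun_mx_diag (f : R[i] -> R[i]) d (v : 'rV[R[i]]_d) :
  fun_mx f (diag_mx v) = diag_mx (map_mx f v).
Proof.
have nv : diag_mx v \is normalmx.
  apply/normalmxP; rewrite tr_diag_mx map_diag_mx !mulmx_diag.
  by congr diag_mx; apply/rowP => i; rewrite !mxE mulrC.
have U := spectral_unit (diag_mx v); rewrite /fun_mx.
have /orthomx_spectralP := nv.
set W := spectralmx _ in U *; set D := spectral_diag _ => E.
have com : diag_mx D *m W = W *m diag_mx v by rewrite E !mulmxA mulmxV // mul1mx.
have fcom : diag_mx (map_mx f D) *m W = W *m diag_mx (map_mx f v).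
  apply/matrixP => i j; rewrite mul_diag_mx mul_mx_diag !mxE.
  have /matrixP/(_ i j) := com; rewrite mul_diag_mx mul_mx_diag !mxE.
  have [->|w0] := eqVneq (W i j) 0; first by rewrite !mulr0 !mul0r.
  by rewrite [W i j * _]mulrC => /(mulIf w0) ->; rewrite mulrC.
by rewrite -mulmxA fcom mulmxA mulVmx // mul1mx.
Qed.

End FunMx.

(** * Relations in the representations *)

Section Relations.
Local Open Scope sesquilinear_scope.
Variables (R : realType) (q : R) (hq : 0 < q < 1) (n : nat).
Local Notation e := (pi_e q n).
Local Notation f := (pi_f q n).
Local Notation k := (pi_k q n).
Local Notation ki := (pi_ki q n).
Local Notation lam := (q - q^-1).

Let q0 : 0 < q. Proof. by case/andP: hq. Qed.
Let qn0 : q != 0. Proof. by rewrite gt_eqF. Qed.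

Lemma qpowD x y : q `^ (x + y) = q `^ x * q `^ y.
Proof. by rewrite powRD // qn0 implybT. Qed.

Lemma qpowNS x : q `^ (- (x + 1)) = q `^ (- x) / q.
Proof. by rewrite opprD qpowD (powRN q 1) powRr1 // ltW. Qed.

Lemma qnum_ge0 x : 0 <= x -> 0 <= qnum q x.
Proof.
move=> x0; have /andP[_ q1] := hq.
have l0 : lam < 0 by rewrite subr_lt0 (lt_trans q1) // invf_gt1.
rewrite /qnum mulr_le0 ?invr_le0 ?(ltW l0) // subr_le0.
by apply: ger_powR; [rewrite q0 ltW|lra].
Qed.

Lemma qnum0 : qnum q 0 = 0.
Proof. by rewrite /qnum oppr0 subrr mul0r. Qed.

Lemma spinB (i : 'I_n.+1) : spin R n - weight R i = (i : nat)%:R.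
Proof. by rewrite /weight subKr. Qed.

Lemma spinD (i : 'I_n.+1) : spin R n + weight R i = n%:R - (i : nat)%:R.
Proof. by rewrite /weight addrA; congr (_ - _); rewrite /spin -splitr. Qed.

Lemma weight_le (i : 'I_n.+1) : 0 <= spin R n + weight R i.
Proof. by rewrite spinD subr_ge0 ler_nat -ltnS. Qed.

Lemma weightS (i j : 'I_n.+1) : i.+1 = j :> nat -> weight R i = weight R j + 1.
Proof. by rewrite /weight => <-; rewrite -natr1; ring. Qed.

Lemma pi_kK : k *m ki = 1%:M.
Proof.
rewrite mulmx_diag; apply/matrixP => i j; rewrite !mxE.
by rewrite -rmorphM /= -qpowD subrr powRr0.
Qed.

Lemma pi_kiK : ki *m k = 1%:M.
Proof.
rewrite mulmx_diag; apply/matrixP => i j; rewrite !mxE.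
by rewrite -rmorphM /= -qpowD addNr powRr0.
Qed.

Lemma pi_e_ki : e *m ki = q%:C *: (ki *m e).
Proof.
apply/matrixP => i j; rewrite mul_mx_diag mul_diag_mx !mxE.
case: eqP => [/weightS ->|_]; last by rewrite mul0r !mulr0.
rewrite -!rmorphM /= mulrA qpowNS.
congr (_%:C); field; exact: qn0.
Qed.

Lemma pi_f_ki : f *m ki = (q^-1)%:C *: (ki *m f).
Proof.
apply/matrixP => i j; rewrite mul_mx_diag mul_diag_mx !mxE.
case: eqP => [ij|_]; last by rewrite mul0r !mulr0.
rewrite (weightS (esym ij)).
rewrite -!rmorphM /= mulrA qpowNS.
congr (_%:C); field; exact: qn0.
Qed.

Lemma pi_ki_e_k : ki *m (e *m k) = (q^-1)%:C *: e.
Proof.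
have kiE : ki *m e = (q^-1)%:C *: (e *m ki).
  by rewrite pi_e_ki scalerA -rmorphM /= mulVf // scale1r.
by rewrite mulmxA kiE -scalemxAl -mulmxA pi_kiK mulmx1.
Qed.

Lemma adj_diag (g : 'I_n.+1 -> R) :
  (diag_mx (\row_i (g i)%:C))^t* = diag_mx (\row_i (g i)%:C).
Proof.
rewrite tr_diag_mx map_diag_mx; congr diag_mx; apply/rowP => i; rewrite !mxE.
exact: conjc_real.
Qed.

Lemma pi_k_adj : k^t* = k. Proof. exact: adj_diag. Qed.
Lemma pi_ki_adj : ki^t* = ki. Proof. exact: (adj_diag (fun i => q `^ (- weight R i))). Qed.

Lemma pi_e_adj : e^t* = f.
Proof.
apply/matrixP => i j; rewrite !mxE.
have [ji|ji] := eqVneq (j.+1) (i : nat); last first.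
  exact: conjc0.
apply: etrans (conjc_real _) _.
by rewrite (weightS ji); congr ((Num.sqrt (qnum q _ * qnum q _))%:C); ring.
Qed.

Lemma pi_ef : e *m f =
  diag_mx (\row_i (qnum q (spin R n - weight R i + 1) * qnum q (spin R n + weight R i))%:C).
Proof.
apply/matrixP => i j; rewrite !mxE.
have [ilt|ige] := ltnP i.+1 n.+1; last first.
  rewrite big1 => [|s _]; last first.
    rewrite !mxE; case: eqP => [is_|_]; last by rewrite mul0r.
    by move: ige; rewrite is_ leqNgt ltn_ord.
  have -> : spin R n + weight R i = 0.
    rewrite spinD (_ : (i : nat) = n) ?subrr //; apply/eqP.
    by rewrite eqn_leq -ltnS ltn_ord.
  by rewrite qnum0 mulr0 mul0rn.
rewrite (bigD1 (Ordinal ilt)) //= big1 ?addr0 => [|s si]; last first.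
  rewrite !mxE; case: eqP => [is_|_]; last by rewrite mul0r.
  by move: si; rewrite -val_eqE /= is_ eqxx.
rewrite !mxE /= eqxx eqSS.
have wS := @weightS i (Ordinal ilt) erefl.
have [/val_inj ij|ij] := eqVneq (i : nat) j; last first.
  by rewrite mulr0 (_ : (i == j) = false) // -val_eqE; apply/negbTE.
rewrite -{}ij eqxx mulr1n -rmorphM /= wS.
have -> : spin R n - (weight R (Ordinal ilt) + 1) + 1 = spin R n - weight R (Ordinal ilt) by ring.
rewrite (addrA _ (weight R _) 1) -expr2 sqr_sqrtr // mulr_ge0 // qnum_ge0 ?spinB //.
by rewrite addr_ge0 ?weight_le.
Qed.

Lemma pi_fe : f *m e =
  diag_mx (\row_i (qnum q (spin R n - weight R i) * qnum q (spin R n + weight R i + 1))%:C).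
Proof.
apply/matrixP => i j; rewrite !mxE.
have [i0|ipos] := posnP i.
  rewrite big1 => [|s _]; last first.
    rewrite !mxE; case: eqP => [is_|_]; last by rewrite mul0r.
    by rewrite i0 in is_.
  by rewrite spinB i0 qnum0 mul0r mul0rn.
have plt : (i.-1 < n.+1)%N by rewrite (leq_ltn_trans (leq_pred _)).
rewrite (bigD1 (Ordinal plt)) //= big1 ?addr0 => [|s si]; last first.
  rewrite !mxE; case: eqP => [is_|_]; last by rewrite mul0r.
  by move: si; rewrite -val_eqE /= is_ eqxx.
rewrite !mxE /= prednK // eqxx.
have wS := @weightS (Ordinal plt) i (prednK ipos).
have [/val_inj ij|ij] := eqVneq (i : nat) j; last first.
  by rewrite mulr0 (_ : (i == j) = false) // -val_eqE; apply/negbTE.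
rewrite -{}ij eqxx mulr1n -rmorphM /= wS.
have -> : spin R n - (weight R i + 1) + 1 = spin R n - weight R i by ring.
rewrite (addrA _ (weight R _) 1) -expr2 sqr_sqrtr // mulr_ge0 // qnum_ge0 ?spinB //.
by rewrite addr_ge0 ?weight_le.
Qed.

(** With a = l - m and b = l + m this is [a + 1] [b] - [a] [b + 1] = [b - a]. *)
Lemma pi_comm : lam%:C *: (e *m f - f *m e) = k *m k - ki *m ki.
Proof.
rewrite pi_ef pi_fe !mulmx_diag; apply/matrixP => i j; rewrite !mxE.
case: (i == j); last by rewrite !mulr0n subrr mulr0.
rewrite !mulr1n -!rmorphM -!rmorphB -rmorphM /=; congr (_%:C).
move: (spin R n) (weight R i) => l w; rewrite /qnum.
rewrite !powRN !qpowD !powRN powRr1 ?(ltW q0) //.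
have x0 : q `^ l != 0 by rewrite gt_eqF ?powR_gt0.
have y0 : q `^ w != 0 by rewrite gt_eqF ?powR_gt0.
have := qdiff_neq0 hq; move: (q `^ l) (q `^ w) x0 y0 => x y x0 y0 l0.
have q2 : q ^+ 2 - 1 != 0.
  apply: contraNneq l0 => /eqP; rewrite subr_eq0 => /eqP q21.
  by apply/eqP/(mulIf qn0); rewrite mulrBl mulVf // -expr2 q21; ring.
by field; rewrite qn0 x0 y0 /= andbT -expr2.
Qed.

End Relations.

(** * The R-matrix on a spin 1/2 factor *)

Definition spin_up : 'I_2 := ord0.
Definition spin_down : 'I_2 := lift ord0 ord0.

Lemma sum_spin (V : nmodType) (G : 'I_2 -> V) : \sum_c G c = G spin_up + G spin_down.
Proof. by rewrite !big_ord_recl big_ord0 addr0. Qed.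

(** The two indices stand for |1/2,1/2> and |1/2,-1/2>. *)
Lemma spin_ind (P : 'I_2 -> Prop) : P spin_up -> P spin_down -> forall a, P a.
Proof.
move=> P0 P1 a; case: (unliftP ord0 a) => [j|] ->; last exact: P0.
by rewrite (ord1 j).
Qed.

Section RMatrix.
Local Open Scope sesquilinear_scope.
Variables (R : realType) (q : R) (hq : 0 < q < 1) (n : nat).
Local Notation e := (pi_e q n).
Local Notation f := (pi_f q n).
Local Notation k := (pi_k q n).
Local Notation ki := (pi_ki q n).
Local Notation lam := (q - q^-1).
Local Notation C := R[i].

Let q0 : 0 < q. Proof. by case/andP: hq. Qed.
Let qn0 : q != 0. Proof. by rewrite gt_eqF. Qed.

(** The matrix with prescribed blocks. *)
Definition of_blk d (B : 'I_2 -> 'I_2 -> 'M[C]_d) : 'M[C]_(d * 2) :=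
  \matrix_(x, y) B (mxtens_unindex x).2 (mxtens_unindex y).2
                   (mxtens_unindex x).1 (mxtens_unindex y).1.

Lemma blk_of_blk d B a b : blk a b (@of_blk d B) = B a b.
Proof. by apply/matrixP => i j; rewrite !mxE !mxtens_indexK. Qed.

Lemma blk_diag d (v : 'rV[C]_(d * 2)) a b :
  blk a b (diag_mx v) = (a == b)%:R *: diag_mx (\row_i v 0 (mxtens_index (i, a))).
Proof.
apply/matrixP => i j; rewrite !mxE (can_eq (@mxtens_indexK d 2)) xpair_eqE.
by case: (i == j); case: (a == b); rewrite ?mulr1n ?mulr0n ?mul1r ?mul0r ?mulr0.
Qed.

Lemma weight0 : weight R spin_up = 2^-1.
Proof. by rewrite /weight /spin subr0 div1r. Qed.

Lemma weight1 : weight R spin_down = - 2^-1.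
Proof. by rewrite /weight /spin (_ : (spin_down : nat) = 1%N) //; field. Qed.

(** The factor q^(h (x) h / 2) of the R-matrix. On the weight vectors of V_(1/2) it acts
    as k and as its inverse. *)
Definition cartan_mx := qpow_mx q (2 *: (j0 R n *t j0 R 1)).

Lemma cartan_mx_blk a b : blk a b cartan_mx =
  (a == b)%:R *: diag_mx (\row_i (q `^ (2 * weight R i * weight R a))%:C).
Proof.
have -> : cartan_mx = diag_mx (\row_x (q `^ (2 * weight R (mxtens_unindex x).1 *
                       weight R (mxtens_unindex x).2))%:C).
  rewrite /cartan_mx /qpow_mx.
  have -> : 2 *: (j0 R n *t j0 R 1) = diag_mx (\row_x (2 * weight R (mxtens_unindex x).1 *
                       weight R (mxtens_unindex x).2)%:C).
    apply: (@blkP _ n.+1 2) => c d; rewrite blkZ blk_tens blk_diag.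
    apply/matrixP => i j; rewrite !mxE !mxtens_indexK /=.
    case: (i == j); case: (c == d); rewrite ?mulr1n ?mulr0n ?mul1r ?mul0r ?mulr0 //.
    by rewrite !rmorphM rmorph_nat /= -mulrA [_%:C * _%:C]mulrC.
  by rewrite fun_mx_diag; congr diag_mx; apply/rowP => x; rewrite !mxE.
rewrite blk_diag; congr (_ *: diag_mx _); apply/rowP => i.
by rewrite !mxE mxtens_indexK.
Qed.

Lemma cartan_mx_blk00 : blk spin_up spin_up cartan_mx = k.
Proof.
rewrite cartan_mx_blk eqxx scale1r; congr diag_mx; apply/rowP => i; rewrite !mxE weight0.
by congr ((q `^ _)%:C); field.
Qed.

Lemma cartan_mx_blk11 : blk spin_down spin_down cartan_mx = ki.
Proof.
rewrite cartan_mx_blk eqxx scale1r; congr diag_mx; apply/rowP => i; rewrite !mxE weight1.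
by congr ((q `^ _)%:C); field.
Qed.

Lemma realCM (x y : R) : x%:C * y%:C = (x * y)%:C :> C.
Proof. by rewrite rmorphM. Qed.

Lemma realCD (x y : R) : x%:C + y%:C = (x + y)%:C :> C.
Proof. by rewrite rmorphD. Qed.

Lemma realCN (x : R) : - x%:C = (- x)%:C :> C.
Proof. by rewrite rmorphN. Qed.

Lemma qhalf : q `^ 2^-1 = q `^ (- 2^-1) * q.
Proof.
by rewrite -{3}(powRr1 (ltW q0)) -(qpowD hq); congr (_ `^ _); field.
Qed.

Lemma qnum1 : qnum q 1 = 1.
Proof.
rewrite /qnum powRN powRr1 ?ltW // divff // subr_eq0 lt_eqF //.
by case/andP: hq => _ q1; rewrite (lt_trans q1) // invf_gt1.
Qed.

Local Notation kf := (pi_ki q 1 *m pi_f q 1).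

Lemma kf_entry a b : kf a b = ((a == spin_down) && (b == spin_up))%:R * (q `^ 2^-1)%:C.
Proof.
rewrite mul_diag_mx !mxE.
elim/spin_ind: a; elim/spin_ind: b; rewrite /= ?mulr0 ?mul0r // !mul1r.
rewrite weight1 weight0 opprK /spin.
have -> : 1 / 2 - 2^-1 + 1 = 1 :> R by field.
have -> : 1 / 2 + 2^-1 = 1 :> R by field.
by rewrite qnum1 mulr1 sqrtr1 mulr1.
Qed.

Lemma kf_sqr : kf *m kf = 0.
Proof.
apply/matrixP => a b; rewrite mxE sum_spin !kf_entry mxE.
elim/spin_ind: a; elim/spin_ind: b; rewrite /= ?mul0r ?mulr0 ?addr0 ?mul1r //.
Qed.

(** As (k^-1 f)^2 = 0 on V_(1/2), the sum breaks off after s = 1. For n = 0 it already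
    stops at s = 0, but e = 0 on V_0. *)
Lemma Rmx_eq : Rmx q n 1 = cartan_mx *m (1%:M + lam%:C *: ((e *m k) *t kf)).
Proof.
rewrite /Rmx -/cartan_mx; congr (_ *m _).
have c0 : (q `^ (0%:R * (0%:R - 1) / 2) * lam ^+ 0 /
    \prod_(1 <= t < 1) qnum q t%:R)%:C = 1 :> C.
  by rewrite !mul0r powRr0 expr0 big_nil invr1 !mulr1.
have tens11 : (1 : 'M[C]_n.+1) *t (1 : 'M[C]_2) = 1%:M.
  apply: (@blkP _ n.+1 2) => a b; rewrite blk_tens blk1 mxE; congr (_ *: _).
rewrite big_ord_recl /= c0 scale1r !expr0 tens11; congr (_ + _).
have [n0|npos] := posnP n.
  have e0 : e = 0.
    apply/matrixP => i j; rewrite !mxE; case: eqP => // ij.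
    have i_n : (i < n)%N by rewrite -ltnS ij.
    by have := leq_ltn_trans (leq0n i) i_n; rewrite [X in (0 < X)%N]n0.
  rewrite e0 mul0mx tens0mx scaler0 big1 // => s _.
  by rewrite (exprS (0 : 'M[C]_n.+1)) mul0r tens0mx scaler0.
rewrite (bigD1 (Ordinal npos)) //= [X in _ + X]big1 ?addr0 => [|s s0]; last first.
  have [m ->] : exists m, bump 0 s = m.+2.
    exists (s : nat).-1; rewrite /bump /= add1n prednK // lt0n.
    by apply: contraNneq s0 => s0; rewrite -val_eqE /= s0.
  have -> : kf ^+ m.+2 = 0 by rewrite !exprS mulrA [kf * kf]kf_sqr mul0r.
  by rewrite tensmx0 scaler0.
rewrite /bump /= !expr1; congr (_%:C *: _).
by rewrite subrr mulr0 mul0r powRr0 mul1r big_nat1 qnum1 divr1.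
Qed.

Lemma cartan_mx_offdiag a b : a != b -> blk a b cartan_mx = 0.
Proof. by move=> ab; rewrite cartan_mx_blk (negbTE ab) scale0r. Qed.

Lemma factor_blk a b : blk a b (1%:M + lam%:C *: ((e *m k) *t kf)) =
  (a == b)%:R *: 1%:M + (((a == spin_down) && (b == spin_up))%:R * (lam * q `^ 2^-1)%:C) *: (e *m k).
Proof.
rewrite blkD blk1 blkZ blk_tens kf_entry scalerA; congr (_ + _ *: _).
by rewrite rmorphM mulrCA.
Qed.

Lemma Rmx_blk00 : blk spin_up spin_up (Rmx q n 1) = k.
Proof.
rewrite Rmx_eq blkM sum_spin !factor_blk cartan_mx_blk00 cartan_mx_offdiag //= mul0mx addr0.
by rewrite mul0r scale0r addr0 scale1r mulmx1.
Qed.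

Lemma Rmx_blk01 : blk spin_up spin_down (Rmx q n 1) = 0.
Proof.
rewrite Rmx_eq blkM sum_spin !factor_blk (@cartan_mx_offdiag spin_up spin_down) //= mul0mx addr0.
by rewrite mul0r !scale0r addr0 mulmx0.
Qed.

Lemma Rmx_blk10 : blk spin_down spin_up (Rmx q n 1) = (lam * q `^ (- 2^-1))%:C *: e.
Proof.
rewrite Rmx_eq blkM sum_spin !factor_blk cartan_mx_blk11 cartan_mx_offdiag //= mul0mx add0r.
rewrite scale0r add0r mul1r -scalemxAr pi_ki_e_k // !scalerA -!rmorphM /=.
congr (_%:C *: _).
rewrite qhalf.
by field.
Qed.

Lemma Rmx_blk11 : blk spin_down spin_down (Rmx q n 1) = ki.
Proof.
rewrite Rmx_eq blkM sum_spin !factor_blk cartan_mx_blk11 cartan_mx_offdiag //= mul0mx add0r.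
by rewrite mul0r scale0r addr0 scale1r mulmx1.
Qed.

(** The inverse of the lower triangular block matrix found in [Rmx_blk00],
    [Rmx_blk01], [Rmx_blk10] and [Rmx_blk11]. *)
Definition Rmx_inverse : 'M[C]_(n.+1 * 2) := of_blk (fun a b =>
  if a == spin_up then (if b == spin_up then ki else 0)
  else (if b == spin_up then (- (lam * q `^ 2^-1))%:C *: e else k)).

Lemma Rmx_mul_inverse : Rmx q n 1 *m Rmx_inverse = 1%:M.
Proof.
apply: (@blkP _ n.+1 2) => a b; rewrite blkM sum_spin blk1 /Rmx_inverse !blk_of_blk /=.
elim/spin_ind: a; elim/spin_ind: b; rewrite /= ?eqxx
  ?Rmx_blk00 ?Rmx_blk01 ?Rmx_blk10 ?Rmx_blk11 ?mul0mx ?mulmx0 ?addr0 ?add0r ?scale1r ?scale0r.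
- exact: pi_kK.
- by [].
- rewrite -scalemxAl -scalemxAr pi_e_ki // scalerA -scalerDl -!rmorphM -rmorphD /=.
  rewrite (_ : _ + _ = 0) ?scale0r //.
  rewrite qhalf.
  by ring.
- exact: pi_kiK.
Qed.

Local Notation P := ((Rmx q n 1)^t* *m Rmx q n 1).
Local Notation P' := (Rmx_inverse *m Rmx_inverse^t*).

Lemma RmxK : P *m P' = 1%:M.
Proof.
rewrite mulmxA -(mulmxA _ (Rmx q n 1)) Rmx_mul_inverse mulmx1 -adjmxM.
by rewrite (mulmx1C Rmx_mul_inverse) trmx1 map_mx1.
Qed.

(** Entry by entry, the algebraic Dirac operator is (R^* R - (R^* R)^-1)/(q - q^-1).
    The diagonal entries amount to the commutator of e and f; the others to moving k^-1
    past e or f, and to [2] = q + q^-1. *)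
Lemma algDirac_blk a b : lam%:C *: algDirac q a b n = blk a b P - blk a b P'.
Proof.
have half2 : q `^ (- 2^-1) * q `^ (- 2^-1) = q^-1.
  by rewrite -qpowD // (_ : _ + _ = -1) ?powRN ?powRr1 ?ltW //; field.
have l0 := qdiff_neq0 hq.
have q2 : qnum q 2 = q + q^-1.
  rewrite /qnum powRN -[2]/(1 + 1 : R) qpowD // powRr1 ?ltW //.
  have : q * q - 1 != 0.
    by apply: contraNneq l0 => h; apply/eqP/(mulfI qn0); rewrite mulr0 mulrBr divff.
  by move=> h; field; rewrite qn0 h.
have comm := @pi_comm R q hq n.
have fk := @pi_f_ki R q hq n.
have ek := @pi_e_ki R q hq n.
have adjR c (x : R) : (x%:C *: (c : 'M[C]_n.+1))^t* = x%:C *: c^t*.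
  by rewrite adjmxZ conjcE conjc_real.
rewrite !blkM !sum_spin !blk_adj /Rmx_inverse !blk_of_blk /algDirac /algDirac_mx.
have z0 : (0 : 'M[C]_n.+1)^t* = 0 by rewrite trmx0 map_mx0.
elim/spin_ind: a; elim/spin_ind: b; rewrite /= ?Rmx_blk00 ?Rmx_blk01 ?Rmx_blk10 ?Rmx_blk11
  ?adjR ?z0 ?pi_e_adj ?pi_k_adj ?pi_ki_adj ?mul0mx ?mulmx0 ?addr0 ?add0r
  -?scalemxAl -?scalemxAr ?scalerA -?rmorphM /=.
- rewrite addrAC -comm scalerBr !scalerDr -addrA !scalerA -scaleNr -scalerDl.
  rewrite realCM realCN realCD; congr (_ + _%:C *: _).
  by rewrite mulrACA half2; field.
- rewrite fk scalerA -scaleNr -scalerDl realCM realCN realCD.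
  by congr (_%:C *: _); rewrite q2 qhalf; field.
- rewrite ek scalerA -scaleNr -scalerDl !(realCM, realCN, realCD).
  by congr (_%:C *: _); rewrite q2 qhalf; field.
- (* order the terms so that the commutator k k - k^-1 k^-1 appears *)
  have swap (A B X : 'M[C]_n.+1) : B - (X + A) = - (A - B) - X.
    by rewrite opprB opprD addrA addrAC.
  rewrite swap -comm scalerBr opprB scalerDr scalerA addrC -addrA; congr (_ + _).
  rewrite -[- (lam%:C *: _)]scaleNr -[- (_ *: (e *m f))]scaleNr -scalerDl.
  rewrite !(realCM, realCN, realCD).
  congr (_%:C *: _).
  rewrite mulrNN qhalf; set x := q `^ _ in half2 *.
  have -> : lam * (x * q) * (lam * (x * q)) = lam * lam * (x * x) * (q * q) by ring.
  by rewrite half2; field.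
Qed.

End RMatrix.

(** * Simultaneous diagonalization of the two Dirac operators *)

Section ClassicalGenerators.
Local Open Scope sesquilinear_scope.
Variables (R : realType) (n : nat).

Lemma jp_adj : (jp R n)^t* = jm R n.
Proof.
apply/matrixP => i j; rewrite !mxE.
have [ji|ji] := eqVneq (j.+1) (i : nat); last exact: conjc0.
apply: etrans (conjc_real _) _; rewrite (weightS R ji).
by congr ((Num.sqrt (_ - _))%:C); ring.
Qed.

(** The x_k are hermitian, hence so is T, and it has an orthonormal eigenbasis. *)
Lemma xgen_adj (k : 'I_3) : (xgen R k n)^t* = xgen R k n.
Proof.
have jmA : (jm R n)^t* = jp R n by rewrite -jp_adj trmxCK.
rewrite /xgen; case: k => [[|[|k]] ?] /=.
- by rewrite adjmxD jp_adj jmA addrC.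
- rewrite adjmxZ -[- jm R n]scaleN1r adjmxD adjmxZ jp_adj jmA.
  rewrite [Num.conj (-1)](_ : _ = -1); last by rewrite rmorphN rmorph1.
  rewrite [Num.conj _](_ : _ = 'i%C); last by rewrite conjcE /= oppr0 opprK.
  by rewrite !scaleN1r scaleNr -scalerN opprB.
- rewrite adjmxZ [Num.conj _](_ : _ = 2); last by rewrite rmorph_nat.
  by congr (_ *: _); rewrite /j0 adj_diag.
Qed.

End ClassicalGenerators.

Lemma Tsym_adj (R : realType) n m : ((Tsym R n m)^t* = Tsym R n m)%sesqui.
Proof.
by rewrite /Tsym adjmx_sum; apply: eq_bigr => k _; rewrite adjmx_tens !xgen_adj.
Qed.

Lemma mulmx_conj (R : comNzRingType) d (V W A B : 'M[R]_d) : W *m V = 1%:M ->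
  (V *m A *m W) *m (V *m B *m W) = V *m (A *m B) *m W.
Proof. by move=> WV; rewrite !mulmxA -(mulmxA _ W V) WV mulmx1. Qed.

Section Diagonalization.
Local Open Scope sesquilinear_scope.
Variables (R : realType) (q : R) (hq : 0 < q < 1) (F : blocks2 R) (hF : is_twist q F).

(** In an eigenbasis of T transported by F, the geometric operator F T F^* is diagonal
    with entries d, and R^* R = F q^T F^* is diagonal with entries q^d. By
    [algDirac_blk] the algebraic operator is then diagonal with entries [d]. *)
Lemma dirac_diag n : exists (V W : 'M[R[i]]_(n.+1 * 2)) (d : 'I_(n.+1 * 2) -> R),
  [/\ V *m W = 1%:M,
      forall a b, geomDirac_tilde F a b n =
        blk a b (V *m diag_mx (\row_k (d k)%:C) *m W) &
      forall a b, algDirac q a b n =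
        blk a b (V *m diag_mx (\row_k (qnum q (d k))%:C) *m W)].
Proof.
pose T := Tsym R n 1.
have Th : T \is hermsymmx by apply: hermsymmxP; exact: Tsym_adj.
have /orthomx_spectralP Tdec := hermitian_normalmx Th.
have Dreal := hermitian_spectral_diag_real Th.
set U := spectralmx T in Tdec; set D := spectral_diag T in Tdec Dreal.
have Uu : U \in unitmx := spectral_unit T.
pose d k := complex.Re (D 0 k).
have DE : D = \row_k (d k)%:C.
  apply/rowP => k; rewrite !mxE /d RRe_real //.
  by have /mxOverP := Dreal; apply.
have Fu := twist_unitary hF n 1.
pose V := F n 1 *m invmx U; pose W := U *m (F n 1)^t*.
have FsF : (F n 1)^t* *m F n 1 = 1%:M by apply: mulmx1C; exact/unitarymxP.
have WV : W *m V = 1%:M.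
  by rewrite /W /V mulmxA -(mulmxA U) FsF mulmx1 mulmxV.
have VW : V *m W = 1%:M by exact: mulmx1C.
have qT : qpow_mx q T = invmx U *m diag_mx (\row_k (q `^ (d k))%:C) *m U.
  by rewrite /qpow_mx /fun_mx -/U -/D; congr (_ *m diag_mx _ *m _);
    apply/rowP => k; rewrite !mxE.
exists V, W, d; split=> // a b.
  transitivity (blk a b (F n 1 *m T *m (F n 1)^t*)) => //.
  by rewrite Tdec DE /V /W !mulmxA.
have PE : (Rmx q n 1)^t* *m Rmx q n 1 = V *m diag_mx (\row_k (q `^ (d k))%:C) *m W.
  by rewrite (twist_Rmx hF) qT /V /W !mulmxA.
pose S := V *m diag_mx (\row_k (q `^ (- d k))%:C) *m W.
have PS : (Rmx q n 1)^t* *m Rmx q n 1 *m S = 1%:M.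
  rewrite PE /S (mulmx_conj _ _ WV) mulmx_diag.
  rewrite (_ : diag_mx _ = 1%:M) ?mulmx1 //.
  apply/matrixP => i j; rewrite !mxE -rmorphM /= -qpowD // subrr powRr0 //.
have P'E : Rmx_inverse q n *m (Rmx_inverse q n)^t* = S.
  by rewrite -[LHS]mul1mx -(mulmx1C PS) -mulmxA RmxK // mulmx1.
have l0 := qdiff_neq0 hq.
have := algDirac_blk hq n a b; rewrite P'E PE.
move=> H; apply: (scalerI (a := (q - q^-1)%:C)).
  by rewrite eq_complex /= negb_and l0.
rewrite H -blkZ -blkN -blkD; congr (blk a b _).
rewrite -mulmxBl -mulmxBr scalemxAl scalemxAr; congr (_ *m _ *m _).
apply/matrixP => i j; rewrite !mxE.
case: (i == j); last by rewrite !mulr0n subrr mulr0.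
rewrite !mulr1n -rmorphB -rmorphM /=; congr (_%:C).
by rewrite /qnum mulrC divfK.
Qed.

(** The eigenvalues at all levels as one function of two natural numbers, so that no
    index type depends on the level. *)
Lemma dirac_diagonalization :
  exists (V W : forall n, 'M[R[i]]_(n.+1 * 2)) (d : nat -> nat -> R), forall n,
  [/\ V n *m W n = 1%:M,
      forall a b, geomDirac_tilde F a b n =
        blk a b (V n *m diag_mx (\row_k (d n k)%:C) *m W n) &
      forall a b, algDirac q a b n =
        blk a b (V n *m diag_mx (\row_k (qnum q (d n k))%:C) *m W n)].
Proof.
pose V n := sval (cid (dirac_diag n)).
pose HV n := svalP (cid (dirac_diag n)).
pose W n := sval (cid (HV n)).
pose HW n := svalP (cid (HV n)).
pose d0 n := sval (cid (HW n)).
pose d n k := if insub k is Some x then d0 n x else 0 : R.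
exists V, W, d => n.
have dE (g : R -> R) : \row_k (g (d n k))%:C = \row_k (g (d0 n k))%:C :> 'rV[R[i]]__.
  by apply/rowP => k; rewrite !mxE /d valK.
rewrite (dE id) (dE (qnum q)).
exact: svalP (cid (HW n)).
Qed.

End Diagonalization.

(** * Eigencomponents of spinors *)

Section Core.
Variables (R : realType) (q : R) (hq : 0 < q < 1).
Variables (h : (Uq R -> R[i]) -> R[i]) (H : completeNormedModType R[i])
  (dot : {dot H for @Num.conj R[i]}) (iota : (Uq R -> R[i]) -> H).
Hypothesis hH : is_L2 q h dot iota.
Local Notation spinor := (spinor_of iota q).

Lemma coeff_fun_linear N s (c c' : blocks R) :
  coeff_fun q N (fun n => s *: c n + c' n) =
  (fun a => s * coeff_fun q N c a + coeff_fun q N c' a).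
Proof.
apply/funext => a; rewrite /coeff_fun mulr_sumr -big_split /=.
apply: eq_bigr => n _; rewrite mulr_sumr -big_split /=.
apply: eq_bigr => i _; rewrite mulr_sumr -big_split /=.
by apply: eq_bigr => j _; rewrite !mxE mulrDl mulrA.
Qed.

Lemma coeff_fun_CSUq2 N c : CSUq2 q (coeff_fun q N c).
Proof. by exists N, c. Qed.

Lemma spinor_linear N s (c c' : 'I_2 -> blocks R) :
  spinor N (fun a n => s *: c a n + c' a n) = s *: spinor N c + spinor N c'.
Proof.
rewrite /spinor_of !coeff_fun_linear !(L2_linear hH) //; exact: coeff_fun_CSUq2.
Qed.

Lemma spinor0 N : spinor N (fun _ _ => 0) = 0.
Proof.
have := spinor_linear N 1 (fun _ _ => 0) (fun _ _ => 0).
rewrite scale1r [X in spinor N X](_ : _ = (fun _ _ => 0)).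
  by move/(congr1 (fun x => x - spinor N (fun _ _ => 0))); rewrite subrr addrK.
by apply/funext => a; apply: functional_extensionality_dep => n; rewrite scaler0 addr0.
Qed.

Lemma spinorZ N s c : spinor N (fun a n => s *: c a n) = s *: spinor N c.
Proof.
rewrite -[RHS]addr0 -(spinor0 N) -spinor_linear; congr (spinor N _).
by apply/funext => a; apply: functional_extensionality_dep => n; rewrite addr0.
Qed.

Lemma spinor_sum (I : Type) N (s : seq I) (phi : I -> R[i]) (c : I -> 'I_2 -> blocks R) :
  spinor N (fun a n => \sum_(p <- s) phi p *: c p a n) =
  \sum_(p <- s) phi p *: spinor N (c p).
Proof.
elim: s => [|p s IH].
  rewrite big_nil -(spinor0 N); congr (spinor N _).
  by apply/funext => a; apply: functional_extensionality_dep => n; rewrite big_nil.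
rewrite big_cons -IH -spinor_linear; congr (spinor N _).
by apply/funext => a; apply: functional_extensionality_dep => n; rewrite big_cons.
Qed.

Lemma eq_spinor N (c c' : 'I_2 -> blocks R) :
  (forall a n, (n < N)%N -> c a n = c' a n) -> spinor N c = spinor N c'.
Proof.
move=> cc; rewrite /spinor_of; congr (iota _, iota _);
  apply/funext => a; apply: eq_bigr => n _; apply: eq_bigr => i _;
  by apply: eq_bigr => j _; rewrite cc.
Qed.

Lemma coeff_fun_widen N N' (c : blocks R) : (N <= N')%N ->
  coeff_fun q N c = coeff_fun q N' (fun n => if (n < N)%N then c n else 0).
Proof.
move=> NN'; apply/funext => a; rewrite /coeff_fun (big_ord_widen N'
  (fun n => \sum_(i < n.+1) \sum_(j < n.+1) c n i j * piq q a n i j)) //.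
rewrite big_mkcond; apply: eq_bigr => n _; case: ltnP => // _.
by rewrite big1 // => i _; rewrite big1 // => j _; rewrite mxE mul0r.
Qed.

Lemma spinor_dense (v : H * H) e : 0 < e ->
  exists N c, hnorm (pdot dot) (v - spinor N c) < e.
Proof.
move=> e0; have e2 : 0 < e / 2 by rewrite divr_gt0.
have dense1 (u : H) : exists N c, hnorm dot (u - iota (coeff_fun q N c)) < e / 2.
  have e2C : 0 < (e / 2)%:C :> R[i] by rewrite ltcR.
  have [||y [By [t [N [c ->]] ty]]] := L2_dense hH (O := ball u (e / 2)%:C).
  - by exists u; exact: ballxx.
  - exact: ball_open.
  - by exists N, c; rewrite ty; apply/(ball_hnorm (L2_norm hH)).
have [N1 [c1 H1]] := dense1 v.1; have [N2 [c2 H2]] := dense1 v.2.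
exists (maxn N1 N2), (fun a n => if a == ord0 then if (n < N1)%N then c1 n else 0
                                 else if (n < N2)%N then c2 n else 0).
rewrite (le_lt_trans (hnorm_pair_le _ _)) // /spinor_of /=.
rewrite -(coeff_fun_widen c1 (leq_maxl N1 N2)) -(coeff_fun_widen c2 (leq_maxr N1 N2)).
by lra.
Qed.

Variables (V W : forall n, 'M[R[i]]_(n.+1 * 2)).
Hypothesis VW : forall n, V n *m W n = 1%:M.

(** The spinor [c] with its k-th eigencomponent at level n multiplied by phi n k. The
    inner matrix lists the pairs (j, a) as tensor indices of V_(n/2) (x) V_(1/2);
    operators act on coefficients through transposes, whence the transposed V and W. *)
Definition eigencomp (c : 'I_2 -> blocks R) (phi : nat -> nat -> R[i]) : 'I_2 -> blocks R :=
  fun a n => \matrix_(i, j)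
    ((\matrix_(i, x) c (mxtens_unindex x).2 n i (mxtens_unindex x).1 : 'M[R[i]]_(n.+1, n.+1 * 2))
     *m (W n)^T *m diag_mx (\row_k phi n k) *m (V n)^T) i (mxtens_index (j, a)).

Lemma eigencomp_linear c s phi psi a n :
  eigencomp c (fun n k => s * phi n k + psi n k) a n = s *: eigencomp c phi a n + eigencomp c psi a n.
Proof.
apply/matrixP => i j; rewrite !mxE mulr_sumr -big_split; apply: eq_bigr => x _ /=.
by rewrite !mul_mx_diag !mxE mulrDr mulrDl mulrCA !mulrA.
Qed.

Lemma eigencomp_ext c phi psi a n :
  (forall k, (k < n.+1 * 2)%N -> phi n k = psi n k) -> eigencomp c phi a n = eigencomp c psi a n.
Proof.
move=> pp; apply/matrixP => i j; rewrite !mxE; apply: eq_bigr => x _.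
by rewrite !mul_mx_diag !mxE pp.
Qed.

Lemma eigencomp_sum (I : Type) (s : seq I) c (t : I -> R[i]) (phi : I -> nat -> nat -> R[i]) a n :
  eigencomp c (fun n k => \sum_(p <- s) t p * phi p n k) a n =
  \sum_(p <- s) t p *: eigencomp c (phi p) a n.
Proof.
elim: s => [|p s IH].
  rewrite big_nil; apply/matrixP => i j; rewrite !mxE big1 // => x _.
  by rewrite mul_mx_diag !mxE big_nil mulr0 mul0r.
rewrite big_cons -IH -eigencomp_linear; apply: eigencomp_ext => k _; by rewrite big_cons.
Qed.

Lemma eigencomp1 c a n : eigencomp c (fun _ _ => 1) a n = c a n.
Proof.
rewrite /eigencomp; set C := (X in X *m (W n)^T).
have -> : diag_mx (\row_k 1) = 1%:M :> 'M[R[i]]_(n.+1 * 2).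
  by apply/matrixP => x y; rewrite !mxE.
rewrite mulmx1 -mulmxA -trmx_mul VW trmx1 mulmx1.
by apply/matrixP => i j; rewrite !mxE !mxtens_indexK.
Qed.

(** An operator which is diagonal in the chosen basis multiplies the components. *)
Lemma spinor_op_eigencomp (X : 'I_2 -> 'I_2 -> blocks R) (psi : nat -> nat -> R[i]) c phi :
    (forall a b n, X a b n = blk a b (V n *m diag_mx (\row_k psi n k) *m W n)) ->
    (forall n, W n *m V n = 1%:M) ->
  forall a n, spinor_op X (eigencomp c phi) a n = eigencomp c (fun n k => phi n k * psi n k) a n.
Proof.
move=> XE WV a n; rewrite /spinor_op /dpartial /eigencomp.
set C := (X in X *m (W n)^T).
have -> : C *m (W n)^T *m diag_mx (\row_k (phi n k * psi n k)) *m (V n)^T =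
  C *m (W n)^T *m diag_mx (\row_k phi n k) *m (V n)^T *m
     (V n *m diag_mx (\row_k psi n k) *m W n)^T.
  rewrite !trmx_mul tr_diag_mx !mulmxA -[_ *m (V n)^T *m (W n)^T]mulmxA -trmx_mul WV.
  rewrite trmx1 mulmx1 -[_ *m diag_mx _ *m diag_mx _]mulmxA mulmx_diag.
  congr (_ *m diag_mx _ *m _); by apply/rowP => k; rewrite !mxE.
set Z := C *m _ *m _ *m _.
apply/matrixP => i j; rewrite [RHS]mxE [RHS]mxE sum_mxtens summxE.
apply: eq_bigr => b _; rewrite mxE; apply: eq_bigr => k _.
by rewrite XE !mxE.
Qed.

End Core.

(** * The theorem *)

Theorem mainTheorem1 (R : realType) (q : R) (hq : 0 < q < 1)
    (F : blocks2 R) (hF : is_twist q F)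
    (h : (Uq R -> R[i]) -> R[i]) (hh : is_haar_state q h)
    (H : completeNormedModType R[i]) (dot : {dot H for @Num.conj R[i]})
    (iota : (Uq R -> R[i]) -> H) (hH : is_L2 q h dot iota)
    (E : spectral_measure (spinor_ip dot))
    (hE : fun_calc E id = closure (core_graph iota q (geomDirac_tilde F))) :
  closure (core_graph iota q (algDirac q)) =
  [set p : (H * H) * (H * H) | exists w1 w2 : H * H,
     fun_calc E (fun x => q `^ x) (p.1, w1) /\
     fun_calc E (fun x => q `^ (- x)) (p.1, w2) /\
     p.2 = ((q - q^-1)^-1)%:C *: (w1 - w2)].
Proof.
have [V [W [d Hd]]] := dirac_diagonalization hq hF.
have VW n : V n *m W n = 1%:M by have [] := Hd n.
have WV n : W n *m V n = 1%:M by exact/mulmx1C/VW.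
have geomE a b n : geomDirac_tilde F a b n =
    blk a b (V n *m diag_mx (\row_k (d n k)%:C) *m W n) by have [_ Hg _] := Hd n; exact: Hg.
have algE a b n : algDirac q a b n =
    blk a b (V n *m diag_mx (\row_k (qnum q (d n k))%:C) *m W n).
  by have [_ _ Ha] := Hd n; exact: Ha.
pose cmp := eigencomp V W.
pose delta (p : nat * nat) n k : R[i] := ((n, k) == p)%:R.
pose E' : spectral_measure (fun u v => pdot dot v u) := E.
pose sp := spinor_of iota q.
pose idx N : seq (nat * nat) := [seq (n, k) | n <- seq.iota 0 N, k <- seq.iota 0 (N * 2)].
(* a spinor is the sum of its components, all of which have n < N and k < 2 N *)
have cmp_sum N c phi : sp N (cmp c phi) =
    \sum_(p <- idx N) phi p.1 p.2 *: sp N (cmp c (delta p)).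
  rewrite /sp -(spinor_sum hH); apply: eq_spinor => a n nN.
  rewrite -eigencomp_sum; apply: eigencomp_ext => k kn.
  have uidx : uniq (idx N).
    by apply: allpairs_uniq; rewrite ?iota_uniq // => -[? ?] [? ?] _ _ /= [-> ->].
  have nk : (n, k) \in idx N.
    apply/allpairsP; exists (n, k); rewrite !mem_iota /= !add0n; split => //.
    by rewrite (leq_trans kn) // leq_mul2r.
  rewrite (bigD1_seq _ nk uidx) /= {1}/delta eqxx mulr1 big1 ?addr0 // => p np.
  by rewrite /delta eq_sym (negbTE np) mulr0.
have op_geom N c p : sp N (spinor_op (geomDirac_tilde F) (cmp c (delta p))) =
    (d p.1 p.2)%:C *: sp N (cmp c (delta p)).
  rewrite /sp -(spinorZ hH); apply: eq_spinor => a n nN.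
  rewrite (@spinor_op_eigencomp _ V W _ (fun n k => (d n k)%:C) c _ geomE WV) -[RHS]addr0.
  have -> : (0 : 'M[R[i]]_n.+1) = eigencomp V W c (fun _ _ => 0) a n.
    apply/matrixP => i j; rewrite !mxE big1 // => x _.
    by rewrite mul_mx_diag !mxE mulr0 mul0r.
  rewrite -eigencomp_linear; apply: eigencomp_ext => k _.
  rewrite /delta addr0; case: eqP => [<-|_] /=; last by rewrite mul0r mulr0.
  by rewrite mul1r mulr1.
pose eig N c := [seq (d p.1 p.2, sp N (cmp c (delta p))) | p <- idx N].
have eigP N c : eigenlist E' (eig N c).
  move=> _ /mapP[p _ ->] /=; apply: eigenvector.
  have : core_graph iota q (geomDirac_tilde F)
      (sp N (cmp c (delta p)), (d p.1 p.2)%:C *: sp N (cmp c (delta p))).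
    by exists N, (cmp c (delta p)); split => //=; rewrite -op_geom.
  by move/subset_closure; rewrite -hE.
have eigensum_eig N c f : eigensum f (eig N c) = sp N (cmp c (fun n k => (f (d n k))%:C)).
  by rewrite cmp_sum /eigensum big_map.
have op_alg N c phi : sp N (spinor_op (algDirac q) (cmp c phi)) =
    sp N (cmp c (fun n k => phi n k * (qnum q (d n k))%:C)).
  by apply: eq_spinor => a n _; rewrite (@spinor_op_eigencomp _ V W _ (fun n k => (qnum q (d n k))%:C) c _ algE WV).
have cmp1 c : cmp c (fun _ _ => 1) = c.
  by apply/funext => a; apply: functional_extensionality_dep => n; exact: eigencomp1.
(* the algebraic operator is [A] on the core, A being the closed geometric one *)
pose G := core_graph iota q (algDirac q).
have G_diag p : G p ->
    exists2 L, eigenlist E' L & p = (eigensum (fun=> 1) L, eigensum (qnum q) L).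
  move=> [N [c [p1 p2]]]; exists (eig N c); first exact: eigP.
  rewrite [p]surjective_pairing p1 p2 !eigensum_eig; congr pair.
    by rewrite cmp1.
  rewrite -{1}(cmp1 c) -/sp op_alg.
  by apply: eq_spinor => a n _; apply: eigencomp_ext => k _; rewrite mul1r.
have G_dense v e : 0 < e ->
    exists2 p, G p & hnorm (pdot dot) (v - (p.2 + 'i%C *: p.1)) < e.
  move=> /(spinor_dense hH v) [N [c vc]].
  (* [A] + i is inverted component by component *)
  pose phi n k : R[i] := ((qnum q (d n k))%:C + 'i%C)^-1.
  exists (sp N (cmp c phi), sp N (spinor_op (algDirac q) (cmp c phi))).
    by exists N, (cmp c phi).
  suff -> : sp N (spinor_op (algDirac q) (cmp c phi)) + 'i%C *: sp N (cmp c phi) = sp N c.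
    exact: vc.
  rewrite op_alg addrC /sp -(spinor_linear hH).
  apply: eq_spinor => a n _; rewrite -eigencomp_linear.
  rewrite -[RHS](eigencomp1 VW); apply: eigencomp_ext => k _.
  have z0 : (qnum q (d n k))%:C + 'i%C != 0.
    by rewrite eq_complex /= addr0 add0r oner_eq0 andbF.
  by rewrite /phi [X in X + _]mulrC -mulrDr addrC mulVf // addrC.
apply/seteqP; split => p.
  move=> /(pair_closureP (L2_norm hH)) cp.
  have [w1 [w2 [f1 f2 e2]]] := closure_sub_qnum hq
    (hnorm_complete (L2_norm hH)) G_diag cp.
  by exists w1, w2.
move=> [w1 [w2 [f1 [f2 p2]]]]; apply/(pair_closureP (L2_norm hH)).
rewrite p2.
exact: (@qnum_sub_closure _ _ _ E' q hq G G_diag G_dense p.1 w1 w2 f1 f2).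
Qed.
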